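(* Let $0<\epsilon_1\le \epsilon_2<\infty$, let $f$ be a probability density on $S=[0,1]^2$ with $\epsilon_1\le f(x)\le \epsilon_2$ for all $x\in S$, and let $F_c$ be the complementary cumulative distribution function of a positive random variable. Suppose there are constants $C,x_0>0$ and $s>3$ such that $$F_c(ax)\le \frac{C}{a^s}F_c(x)\quad\text{for all } a>1\text{ and } x>x_0.$$ For sequences $(r_n)$, $(p_n)$ with $0<r_n<1$, $0<p_n<1$, let $G=G(r_n)$ be the Bernoulli random geometric graph on $\{1,\dots,n\}$ with location density $f$, adjacency distance $r_n$, edge probability $p_n$ and i.i.d. edge weights with ccdf $F_c$; let $\tau_n$ be the maximum weight of a spanning tree of the largest component of $G$; and for $z>0$ let $H(z)=\sup\{x>0:F_c(x)\ge 1/z\}$ (all as specified in the context). There is a constant $\gamma>0$ such that for any constant $M>\gamma$, all sequences $(r_n),(p_n)$ with $0<r_n<1$, $0<p_n<1$ satisfying $nr_n^2p_n\ge M\log n$ for all sufficiently large $n$, any $L=L(n)>0$ and any $2<s_1<s$, we have, for all sufficiently large $n$, $$\mathrm{var}(\tau_n)\le \gamma n\left(\sigma_{loc}^2+\sigma_{wt}^2\right),$$ where $$\sigma_{loc}^2:=(nr_n^2p_n)^2\left(L^2+n^4r_n^2p_n F_c(L)+n^2\left(F_c(L)\right)^{1-2/s_1}\right)+n^6e^{-\gamma^{-1}nr_n^2p_n}$$ and $$\sigma_{wt}^2:=\left(H(nr_n^2p_n)\right)^2.$$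
   Context: Setting. $K_n$ is the complete graph on vertex set $\{1,\dots,n\}$. For each $n$, the following three families are independent of each other: (i) the edge states $\{Z(e)\}_{e\in K_n}$, i.i.d. Bernoulli with $\mathbb{P}(Z(e)=1)=p_n=1-\mathbb{P}(Z(e)=0)$; (ii) the edge weights $\{W(e)\}_{e\in K_n}$, i.i.d. positive random variables with complementary cumulative distribution function (ccdf) $F_c(x)=\mathbb{P}(W(e)>x)$, $x>0$, where $F_c$ does not depend on $n$; (iii) the vertex locations $X_1,\dots,X_n$, i.i.d. in $S=[0,1]^2$ with density $f$. The Bernoulli random geometric graph $G=G(r_n)$ with adjacency distance $r_n$ and edge probability $p_n$ is the random subgraph of $K_n$ on vertex set $\{1,\dots,n\}$ whose edges are all $(u,v)$ with $d(X_u,X_v)<r_n$ and $Z(u,v)=1$, where $d$ is Euclidean distance. A tree is a connected acyclic subgraph of $G$; its weight is the sum of $W(e)$ over its edges $e$. A spanning tree of a component $\mathcal{C}$ of $G$ is a tree in $\mathcal{C}$ containing all vertices of $\mathcal{C}$. $\tau_n$ is the maximum weight of a spanning tree of the largest component (most vertices; ties broken by any fixed rule) of $G$. Constants do not depend on $n$. *)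

(* Defs.v *)
From HB Require Import structures.
From mathcomp Require Import all_boot all_order all_algebra.
From mathcomp Require Import all_classical all_reals all_analysis.
Set Implicit Arguments.
Unset Strict Implicit.
Unset Printing Implicit Defensive.
Import Order.TTheory GRing.Theory Num.Theory.
Import numFieldNormedType.Exports.
Local Open Scope classical_set_scope.
Local Open Scope ring_scope.

(* Edges of the complete graph K_n, as the two-element sets of vertices. A
   subgraph of K_n is given by its set of edges, with vertex set 'I_n unless
   another vertex set is specified. *)
Definition edge (n : nat) : finType := {e : {set 'I_n} | #|e| == 2}.

Definition adj (n : nat) (G : {set edge n}) : rel 'I_n :=
  fun u v => [exists e in G, val e == [set u; v]%SET].

Definition component (n : nat) (G : {set edge n}) (u : 'I_n) : {set 'I_n} :=
  [set v | connect (adj G) u v]%SET.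

Definition components (n : nat) (G : {set edge n}) : {set {set 'I_n}} :=
  [set component G u | u : 'I_n]%SET.

Definition largest_components (n : nat) (G : {set edge n}) : {set {set 'I_n}} :=
  [set C in components G | [forall D in components G, (#|D| <= #|C|)%N]]%SET.

(* A deterministic rule selecting, for every graph, one of its components of
   maximum size. The case n = 0 has to be excluded: there is no component. *)
Definition tie_breaking_rule (tie : forall n, {set edge n} -> {set 'I_n}) :
    Prop :=
  forall n (G : {set edge n}), (0 < n)%N -> tie n G \in largest_components G.

(* No cycle, i.e. no cyclic sequence of at least three distinct vertices in
   which consecutive vertices are adjacent. *)
Definition acyclic (n : nat) (T : {set edge n}) : Prop :=
  forall c : seq 'I_n, ucycle (adj T) c -> (size c < 3)%N.

(* (C, T) is a connected acyclic subgraph of G. *)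
Definition spanning_tree (n : nat) (G : {set edge n}) (C : {set 'I_n})
    (T : {set edge n}) : Prop :=
  [/\ T \subset G,
      forall e, e \in T -> val e \subset C,
      forall u v, u \in C -> v \in C -> connect (adj T) u v
    & acyclic T].

Section random_geometric_graph.
Variable R : realType.

Definition weight (n : nat) (w : edge n -> R) (T : {set edge n}) : R :=
  \sum_(e in T) w e.

(* Weights are positive, so that taking 0 as the unit of the maximum is
   harmless. *)
Definition max_spanning_tree_weight (n : nat) (G : {set edge n})
    (C : {set 'I_n}) (w : edge n -> R) : R :=
  \big[Num.max/0]_(T : {set edge n} | `[< spanning_tree G C T >]) weight w T.

(* The norm of the library on R * R is the maximum norm. *)
Definition euclidean_dist (x y : R * R) : R :=
  Num.sqrt ((x.1 - y.1) ^+ 2 + (x.2 - y.2) ^+ 2).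

Definition rgg (n : nat) (r : R) (z : edge n -> bool) (x : 'I_n -> R * R) :
    {set edge n} :=
  [set e | z e && [forall u in val e, forall v in val e,
                     (u != v) ==> (euclidean_dist (x u) (x v) < r)]]%SET.

Definition unit_square : set (R * R) := `[0, 1] `*` `[0, 1].

Definition lebesgue2 := (@lebesgue_measure R \x @lebesgue_measure R)%E.

Definition density_on_square (f : R * R -> R) : Prop :=
  [/\ measurable_fun unit_square f,
      forall x, unit_square x -> 0 <= f x
    & (\int[lebesgue2]_(x in unit_square) (f x)%:E = 1)%E].

(* Only the values of Fc on the positive reals are relevant. *)
Definition has_ccdf d (Omega : measurableType d) (P : probability Omega R)
    (W : {RV P >-> R}) (Fc : R -> R) : Prop :=
  forall x, 0 < x -> ccdf W x = (Fc x)%:E.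

Definition ccdf_of_positive (Fc : R -> R) : Prop :=
  exists d (Omega : measurableType d) (P : probability Omega R)
    (W : {RV P >-> R}), (forall t, 0 < W t) /\ has_ccdf W Fc.

Section independence.
Context d (Omega : measurableType d) (P : probability Omega R).

Definition preimage_sigma d' (U : measurableType d') (X : {RV P >-> U}) :
    set_system Omega :=
  preimage_set_system setT X measurable.

Definition mutually_independent (I : finType) d' (U : measurableType d')
    (X : I -> {RV P >-> U}) : Prop :=
  forall (J : {set I}) (A : I -> set Omega),
    (forall i, i \in J -> preimage_sigma (X i) (A i)) ->
    (P (\bigcap_(i in [set` J]) A i) = \prod_(i in J) P (A i))%E.

Definition family_sigma (I : finType) d' (U : measurableType d')
    (X : I -> {RV P >-> U}) : set_system Omega :=
  <<s \bigcup_i preimage_sigma (X i) >>.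

(* Each sigma-algebra contains the whole space, so that pairwise product rules
   are included. *)
Definition independent3 (F G H : set_system Omega) : Prop :=
  forall A B C, F A -> G B -> H C ->
    (P (A `&` B `&` C) = P A * P B * P C)%E.

Record bernoulli_rgg_model (n : nat) (f : R * R -> R) (Fc : R -> R) (p : R)
    (Z : edge n -> {RV P >-> bool}) (W : edge n -> {RV P >-> R})
    (X : 'I_n -> {RV P >-> (R * R)%type}) : Prop := {
  state_law : forall e, P (Z e @^-1` [set true]) = p%:E ;
  state_indep : mutually_independent Z ;
  weight_gt0 : forall e t, 0 < W e t ;
  weight_law : forall e, has_ccdf (W e) Fc ;
  weight_indep : mutually_independent W ;
  location_law : forall i A, measurable A ->
    P (X i @^-1` A) = (\int[lebesgue2]_(x in A `&` unit_square) (f x)%:E)%E ;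
  location_indep : mutually_independent X ;
  families_indep :
    independent3 (family_sigma Z) (family_sigma W) (family_sigma X) }.

Definition tau (tie : forall n, {set edge n} -> {set 'I_n}) (n : nat) (r : R)
    (Z : edge n -> {RV P >-> bool}) (W : edge n -> {RV P >-> R})
    (X : 'I_n -> {RV P >-> (R * R)%type}) : Omega -> R :=
  fun t => let G := rgg r (fun e => Z e t) (fun i => X i t) in
    max_spanning_tree_weight G (tie n G) (fun e => W e t).

End independence.

(* sup is 0 on the empty set and on unbounded sets; neither case occurs for
   z > 1 when Fc is the ccdf of a positive random variable. *)
Definition tail_quantile (Fc : R -> R) (z : R) : R :=
  sup [set x | 0 < x /\ z^-1 <= Fc x].

Definition sigma_loc2 (Fc : R -> R) (gamma s1 : R) (n : nat) (r p L : R) : R :=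
  (n%:R * r ^+ 2 * p) ^+ 2 *
    (L ^+ 2 + n%:R ^+ 4 * r ^+ 2 * p * Fc L
     + n%:R ^+ 2 * (Fc L `^ (1 - 2 / s1)))
  + n%:R ^+ 6 * expR (- (gamma^-1 * (n%:R * r ^+ 2 * p))).

Definition sigma_wt2 (Fc : R -> R) (n : nat) (r p : R) : R :=
  tail_quantile Fc (n%:R * r ^+ 2 * p) ^+ 2.

End random_geometric_graph.

(* Main.v *)
(* Apply the Efron-Stein inequality to the independent blocks formed by the
   location of a vertex i together with the states and weights of some of the
   edges at i. If the graph stays connected without i, then deleting i changes
   tau_n by at most the total weight of the edges at i; since the weights are
   independent of which edges are present, that weight has second moment of order
   (n r^2 p)^2 E[W^2], and the tail condition gives
   E[W^2] <= L^2 + K Fc(L)^(1 - 2/s1). Otherwise the change is at most the sum of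
   all weights, which is independent of the event of disconnection; the
   probability of this event is at most of order
   n^2 exp(-c n r^2 p) by a Chernoff bound for the number of vertices in the
   cells of a grid of side comparable to r and a union bound over the cuts of
   the Erdos-Renyi graphs in its 2 x 2 windows. *)

(* The comparison functional for vertex [i] is the maximum weight of a spanning tree on the vertices
   other than [i]. It reads no variable at [i], so resampling the block of [i] leaves its value
   unchanged. Each edge is filed under one of its endpoints only, so that the blocks partition the
   variables. Efron-Stein itself comes from a quadrilateral inequality in L2 and the exchangeability
   of the variables with an independent copy.

   Two moment bounds are used. The incident weight uses the given [L] and [s1]; the event of
   disconnection uses [L = 1] and [s1 = 3], hence a number fixed in advance, because the term
   [n^6 exp (- D / gamma)], where [D = n r^2 p], contains no [L]. As [gamma] is chosen before [s1],
   the factor K of the first bound, which depends on [s1], cannot enter [gamma]; for large [n] it is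
   absorbed by [n^2].

   [gamma] is both a factor and a threshold: [D >= gamma log n] must make [n exp (- eps1 D / 256)]
   at most 1/2, and [1 / gamma] must not exceed [eps1 / 256]. *)
Require Import Defs.
From HB Require Import structures.
From mathcomp Require Import all_boot all_order all_algebra.
From mathcomp Require Import all_classical all_reals all_analysis.
From mathcomp Require Import measurable_realfun ring lra zify.
Import Order.TTheory GRing.Theory Num.Theory.
Import numFieldNormedType.Exports.
Local Open Scope classical_set_scope.
Local Open Scope ring_scope.
Set Implicit Arguments.
Unset Strict Implicit.
Unset Printing Implicit Defensive.

(** * Spanning trees and vertex deletion *)

Section graphs.
Context {n : nat}.
Implicit Types (F G T : {set edge n}) (C : {set 'I_n}) (u v i : 'I_n).

Lemma adj_sym G : symmetric (adj G).
Proof. by move=> u v; apply: eq_existsb => e; rewrite finset.setUC. Qed.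

Lemma adj_sub G G' : G \subset G' -> subrel (adj G) (adj G').
Proof.
move=> /fintype.subsetP sG u v /existsP[e /andP[eG euv]].
by apply/existsP; exists e; rewrite sG.
Qed.

Lemma connect_adj_sub G G' : G \subset G' ->
  subrel (connect (adj G)) (connect (adj G')).
Proof.
by move=> sG; apply: connect_sub => u v uv; apply/connect1/(adj_sub sG).
Qed.

Lemma connect_adj_sym G : connect_sym (adj G).
Proof. exact/sym_connect_sym/adj_sym. Qed.

Lemma acyclic_sub T T' : T \subset T' -> acyclic T' -> acyclic T.
Proof.
move=> sT aT' c /andP[cT cU]; apply: aT'; rewrite /ucycle cU andbT.
exact: sub_cycle (adj_sub sT) _ cT.
Qed.

Lemma adjU1 (e : edge n) T x y : adj (e |: T)%SET x y ->
  adj T x y \/ val e = [set x; y]%SET.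
Proof.
move=> /existsP[e' /andP[]]; rewrite in_setU1 => /orP[/eqP ->|e'T] /eqP e'xy.
  by right.
by left; apply/existsP; exists e'; rewrite e'T e'xy eqxx.
Qed.

Lemma set2_eqP (x y z t : 'I_n) : [set x; y]%SET = [set z; t]%SET ->
  x = z /\ y = t \/ x = t /\ y = z.
Proof.
move=> E.
have : x \in [set z; t]%SET by rewrite -E set21.
have : y \in [set z; t]%SET by rewrite -E set22.
have : z \in [set x; y]%SET by rewrite E set21.
have : t \in [set x; y]%SET by rewrite E set22.
rewrite !in_set2.
by do 4! (case/orP => /eqP ?); subst; intuition.
Qed.

(** A cycle of length at least three through the new edge becomes, once that edge is removed, a path
    of [T] between its endpoints, and these are not connected in [T]. *)
Lemma acyclicU1 (e : edge n) T a b : val e = [set a; b]%SET ->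
  ~~ connect (adj T) a b -> acyclic T -> acyclic (e |: T)%SET.
Proof.
move=> eab nab aT c /andP[cT cU].
have [cT'|ncT'] := boolP (cycle (adj T) c); first by apply: aT; apply/andP.
have [x xc nx] : exists2 x, x \in c & ~~ adj T x (next c x).
  apply: contrapT => nex; move/negP: ncT'; apply.
  apply: cycle_from_next => // x xc; apply: contrapT => /negP nx.
  by apply: nex; exists x.
have ex : val e = [set x; next c x]%SET.
  by case: (adjU1 (next_cycle cT xc)) => // h; rewrite h in nx.
rewrite ltnNge; apply/negP => c3.
have yc : next c x \in c by rewrite mem_next.
(* The cycle is rotated to start just after the new edge: it reads [y :: p] with last vertex [x],
   and the new edge is the closing step. *)
have [j p rotc] := rot_to yc.
set y := next c x in ex nx yc rotc.
have pcT : cycle (adj (e |: T)%SET) (y :: p) by rewrite -rotc rot_cycle.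
have pcU : uniq (y :: p) by rewrite -rotc rot_uniq.
have p2 : (1 < size p)%N by rewrite -[size p]/(size (y :: p)).-1 -rotc size_rot; case: (size c) c3.
have lastp : last y p = x.
  have := prev_next cU x; rewrite -/y -(prev_rot j) // rotc.
  rewrite prev_nth mem_head memNindex; last by case/andP: pcU.
    by rewrite -[size p]/(size (y :: p)).-1 nth_last => <-.
(* No step of [p] is the new edge again: by uniqueness it would either end at position 0, or be the
   closing step backwards, which forces [size p = 1]. *)
have : path (adj T) y p.
  apply/(pathP y) => k kp.
  have /(pathP y)/(_ k) : path (adj (e |: T)%SET) y p.
    by have := pcT; rewrite /= rcons_path => /andP[].
  have U a' b' : (a' <= size p)%N -> (b' <= size p)%N ->
      nth y (y :: p) a' = nth y (y :: p) b' -> a' = b'.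
    by move=> ? ? /eqP; rewrite nth_uniq ?ltnS //= => /eqP.
  have xE : x = nth y (y :: p) (size p) by rewrite -lastp (last_nth y).
  move=> /(_ kp) /adjU1 [//|eE]; move: ex; rewrite eE => /esym /set2_eqP [[_ yE]|[x'E yE]].
    by have := U 0%N k.+1 (leq0n _) kp yE.
  have k0 := U 0%N k (leq0n _) (ltnW kp) yE.
  have := U (size p) k.+1 (leqnn _) kp (etrans (esym xE) x'E).
  by rewrite -k0 => E; rewrite E in p2.
move=> pT; have : connect (adj T) y x by apply/connectP; exists p.
move: ex nab; rewrite eab => /set2_eqP[[-> ->]|[-> ->]] /negbTE.
  by rewrite connect_adj_sym => ->.
by move=> ->.
Qed.

Definition inner G C : {set edge n} := [set e in G | val e \subset C]%SET.

Lemma inner_sub G C : inner G C \subset G.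
Proof. by apply/fintype.subsetP => e; rewrite inE => /andP[]. Qed.

Lemma connect_notP G T u v : ~~ connect (adj T) u v -> connect (adj G) u v ->
  exists a b, adj G a b /\ ~~ connect (adj T) a b.
Proof.
move=> nuv /connectP[p]; elim: p u nuv => [|w p IH] u nuv /=.
  by move=> _ vu; rewrite vu connect0 in nuv.
move=> /andP[uw wp] vE.
have [cuw|ncuw] := boolP (connect (adj T) u w); last by exists u, w.
apply: (IH w) => //; apply: contra nuv; exact: connect_trans.
Qed.

(** A maximal acyclic set between [F] and [inner G C] must connect [C]: otherwise some edge of
    [inner G C] joins two of its components and can be added by [acyclicU1]. *)
Lemma forest_extension G C F :
    (forall u v, u \in C -> v \in C -> connect (adj (inner G C)) u v) ->
    F \subset inner G C -> acyclic F ->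
  exists2 T, spanning_tree G C T & F \subset T.
Proof.
move=> Ccon FG aF.
pose Q := [pred T : {set edge n} | [&& F \subset T, T \subset inner G C & `[< acyclic T >]]].
have QF : Q F by rewrite /= fintype.subxx FG; apply/asboolP.
case: (arg_maxnP (fun T : {set edge n} => #|T|) QF) => T /and3P[FT TG /asboolP aT] Tmax.
exists T => //; split=> //.
- exact: fintype.subset_trans TG (inner_sub _ _).
- by move=> e /(fintype.subsetP TG); rewrite inE => /andP[].
move=> u v uC vC; apply: contrapT => /negP nuv.
have [a [b [/existsP[e /andP[eG /eqP eab]] nab]]] := connect_notP nuv (Ccon _ _ uC vC).
have eT : e \notin T.
  apply: contra nab => eT; apply/connect1/existsP.
  by exists e; rewrite eT eab eqxx.
have /Tmax : Q (e |: T)%SET.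
  rewrite /= (fintype.subset_trans FT) ?finset.subsetUr// finset.subUset finset.sub1set eG TG/=.
  exact/asboolP/(acyclicU1 eab).
by rewrite /geq /= cardsU1 eT add1n ltnn.
Qed.

End graphs.

Section max_spanning_tree.
Context {R : realType} {n : nat}.
Implicit Types (F G T : {set edge n}) (C : {set 'I_n}) (i : 'I_n)
  (w : edge n -> R).

Lemma weight_sub w T T' : (forall e, 0 < w e) -> T \subset T' ->
  weight w T <= weight w T'.
Proof.
move=> w0 sT; rewrite /weight (big_setID T (A := T')) /= (finset.setIidPr sT).
by rewrite lerDl; apply: sumr_ge0 => e _; exact: ltW.
Qed.

Lemma max_spanning_tree_weight_ge G C w T : spanning_tree G C T ->
  weight w T <= max_spanning_tree_weight G C w.
Proof. by move=> hT; apply: le_bigmax_cond; apply/asboolP. Qed.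

Lemma max_spanning_tree_weight_le G C w (b : R) : 0 <= b ->
    (forall T, spanning_tree G C T -> weight w T <= b) ->
  max_spanning_tree_weight G C w <= b.
Proof. by move=> b0 bT; apply: bigmax_le => // T /asboolP; exact: bT. Qed.

Lemma max_spanning_tree_weight_ge0 G C w : 0 <= max_spanning_tree_weight G C w.
Proof. exact: bigmax_ge_id. Qed.

Lemma max_spanning_tree_weight_bound G C w : (forall e, 0 < w e) ->
  max_spanning_tree_weight G C w <= \sum_e w e.
Proof.
move=> w0; apply: max_spanning_tree_weight_le => [|T _].
  by apply: sumr_ge0 => e _; exact: ltW.
have -> : \sum_e w e = weight w [set: edge n]%SET.
  by apply: eq_bigl => e; rewrite finset.in_setT.
exact: weight_sub w0 (finset.subsetT T).
Qed.

Definition incident_weight G w i : R := \sum_(e in G | i \in val e) w e.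

(** A boolean, so that it is a predicate on graphs and defines a measurable event. *)
Definition inner_connected G C :=
  [forall u in C, forall v in C, connect (adj (inner G C)) u v].

Lemma inner_connectedP G C : reflect
  (forall u v, u \in C -> v \in C -> connect (adj (inner G C)) u v)
  (inner_connected G C).
Proof.
apply: (iffP forall_inP) => h.
  by move=> u v uC vC; have /forall_inP := h u uC; exact.
by move=> u uC; apply/forall_inP => v vC; exact: h.
Qed.

Lemma acyclic_inner T i : acyclic T -> acyclic (inner T [set~ i]%SET).
Proof. exact/acyclic_sub/inner_sub. Qed.

Lemma inner_setT G : inner G [set: 'I_n]%SET = G.
Proof. by apply/setP => e; rewrite inE finset.subsetT andbT. Qed.

(** All vertices but [i] lie in one component, so a largest component has at least [n - 1 >= 2]
    vertices, meets that component and hence equals it. For [n = 2] the tie could be broken in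
    favour of the isolated vertex [i]. *)
Lemma largest_component_setC1 G C i : (2 < n)%N ->
  inner_connected G [set~ i]%SET -> C \in largest_components G ->
  C = [set~ i]%SET \/ C = [set: 'I_n]%SET /\ inner_connected G [set: 'I_n]%SET.
Proof.
move=> n2 /inner_connectedP Gi; rewrite inE => /andP[/imsetP[u _ CE] /forall_inP Cmax].
have [v0 v0i] : exists v0, v0 \in [set~ i]%SET.
  by apply/card_gt0P; rewrite cardsC1 card_ord; case: (n) n2 => [|[]].
have sub v : v \in [set~ i]%SET -> [set~ i]%SET \subset component G v.
  move=> vi; apply/fintype.subsetP => w wi; rewrite inE.
  exact: connect_adj_sub (inner_sub _ _) _ _ (Gi _ _ vi wi).
have C2 : (1 < #|C|)%N.
  have /Cmax : component G v0 \in components G by apply/imsetP; exists v0.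
  apply: leq_trans; apply: leq_trans (subset_leq_card (sub _ v0i)).
  by rewrite cardsC1 card_ord; case: (n) n2 => [|[|[]]].
have [v vC vi] : exists2 v, v \in C & v \in [set~ i]%SET.
  have /card_gt1P[x [y [xC yC xy]]] := C2.
  have [xi|xi] := eqVneq x i; last by exists x => //; rewrite !inE.
  by exists y => //; rewrite !inE -xi eq_sym.
have uv : connect (adj G) u v by rewrite CE inE in vC.
have vCE : component G v = C.
  by rewrite CE; apply/setP => w; rewrite !inE (same_connect (@connect_adj_sym _ G) uv).
have sC : [set~ i]%SET \subset C by rewrite -vCE sub.
have [iC|iC] := boolP (i \in C); last first.
  left; apply/eqP; rewrite finset.eqEsubset sC andbT.
  by apply/fintype.subsetP => w wC; rewrite !inE; apply: contraNneq iC => <-.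
have CT : C = [set: 'I_n]%SET.
  apply/eqP; rewrite -finset.subTset; apply/fintype.subsetP => w _.
  have [->//|wi] := eqVneq w i.
  by apply: (fintype.subsetP sC); rewrite !inE.
right; split => //; apply/inner_connectedP => x y _ _; rewrite inner_setT.
have : x \in C by rewrite CT.
have : y \in C by rewrite CT.
rewrite -vCE !inE => vy vx; apply: connect_trans vy.
by rewrite connect_adj_sym.
Qed.

(* Deleting the edges at [i] from an optimal tree leaves a forest on the other
   vertices, and conversely an optimal tree on the other vertices is a forest of
   [G]; both extend to spanning trees. *)
Lemma max_spanning_tree_weight_delete G C w i : (2 < n)%N ->
    (forall e, 0 < w e) ->
    inner_connected G [set~ i]%SET -> C \in largest_components G ->
  `|max_spanning_tree_weight G C w - max_spanning_tree_weight G [set~ i]%SET w|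
    <= incident_weight G w i.
Proof.
move=> n2 w0 Gi hC.
have inc0 : 0 <= incident_weight G w i by apply: sumr_ge0 => e _; exact: ltW.
have [->|[-> /inner_connectedP GT]] := largest_component_setC1 n2 Gi hC.
  by rewrite subrr normr0.
rewrite ger0_norm; last first.
  rewrite subr_ge0; apply: max_spanning_tree_weight_le.
    exact: max_spanning_tree_weight_ge0.
  move=> T [TG _ _ aT].
  have [|T' hT' sT'] := forest_extension GT _ aT; first by rewrite inner_setT.
  exact: le_trans (weight_sub w0 sT') (max_spanning_tree_weight_ge w hT').
rewrite lerBlDl; apply: max_spanning_tree_weight_le.
  by rewrite addr_ge0// max_spanning_tree_weight_ge0.
move=> T [TG _ _ aT].
have [|T' hT' sT'] := forest_extension (inner_connectedP _ _ Gi) _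
  (@acyclic_inner _ i aT).
  apply/fintype.subsetP => e; rewrite !inE => /andP[eT ->].
  by rewrite (fintype.subsetP TG).
rewrite /weight (big_setID (inner T [set~ i]%SET)) /=; apply: lerD.
  rewrite (finset.setIidPr (inner_sub _ _)).
  exact: le_trans (weight_sub w0 sT') (max_spanning_tree_weight_ge w hT').
rewrite /incident_weight big_mkcond [leRHS]big_mkcond/=.
apply: ler_sum => e _; rewrite !inE negb_and.
have [eT|] := boolP (e \in T); rewrite ?andbF /=; last by case: ifP => // _ _; exact: ltW.
rewrite (fintype.subsetP TG)//=; case: ifP => [|_]; last by case: ifP => // _; exact: ltW.
rewrite andbT => /fintype.subsetPn[u ue]; rewrite !inE negbK => /eqP uE.
by rewrite -uE ue.
Qed.

End max_spanning_tree.

(** * The Efron-Stein inequality *)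

Section cylinders.
Context {K : finType} {d} {U : measurableType d}.

Definition cylinder (A : K -> set U) : set (K -> U) :=
  [set v | forall k, A k (v k)].

Definition cylinders : set_system (K -> U) :=
  [set cylinder A | A in [set A | forall k, measurable (A k)]].

(** The finite product sigma-algebra. Its generators are closed under intersection, so a law on it
    is determined by its values on rectangles, the form in which independence is stated. *)
Definition family : measurableType cylinders.-sigma := g_sigma_algebraType cylinders.

Lemma measurable_family d' (T : measurableType d') (xi : K -> T -> U) :
  (forall k, measurable_fun setT (xi k)) ->
  measurable_fun setT (fun t => xi^~ t : family).
Proof.
move=> mxi; apply: (@measurability _ _ T family setT _ cylinders) => // _ [_ [A mA <-] <-].
rewrite setTI [X in measurable X](_ : _ = \bigcap_(k in setT) (xi k @^-1` A k)).
  apply: fin_bigcap_measurable; first exact: finite_finset.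
  by move=> k _; rewrite -[X in measurable X]setTI; exact: mxi.
by apply/seteqP; split=> t /= h k; [move=> _|]; exact: h.
Qed.

Lemma measurable_coord k : measurable_fun setT (fun v : family => v k).
Proof.
move=> _ B mB; apply: sub_sigma_algebra.
exists (fun j => if j == k then B else setT).
  by move=> j /=; case: ifP.
rewrite setTI; apply/seteqP; split=> v /=; first by move/(_ k); rewrite eqxx.
by move=> vB j; case: eqP => [->|].
Qed.

Lemma cylinders_setI : setI_closed cylinders.
Proof.
move=> _ _ [A mA <-] [B mB <-]; exists (fun k => A k `&` B k).
  by move=> k; exact: measurableI.
by apply/seteqP; split=> v /= h; [split=> k; case: (h k)|move=> k; split; apply h].
Qed.

(** Laws that agree on the pi-system of cylinders coincide, and both integrals are integrals against
    these laws. The underlying spaces may differ, so that [P \x P] can be compared with [P]. *)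
Lemma integral_family_eq_law (R : realType)
    d1 (T1 : measurableType d1) (m1 : {measure set T1 -> \bar R})
    d2 (T2 : measurableType d2) (m2 : {measure set T2 -> \bar R})
    (eta1 : T1 -> family) (eta2 : T2 -> family) (h : family -> \bar R) :
    (m1 setT < +oo)%E -> measurable_fun setT eta1 -> measurable_fun setT eta2 ->
    (forall A : K -> set U, (forall k, measurable (A k)) ->
      m1 (eta1 @^-1` cylinder A) = m2 (eta2 @^-1` cylinder A)) ->
    measurable_fun setT h -> (forall v, 0 <= h v)%E ->
  (\int[m1]_x h (eta1 x) = \int[m2]_x h (eta2 x))%E.
Proof.
move=> m1oo meta1 meta2 E mh h0.
pose X1 : {mfun T1 >-> family} := HB.pack eta1 (isMeasurableFun.Build _ _ _ _ _ meta1).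
pose X2 : {mfun T2 >-> family} := HB.pack eta2 (isMeasurableFun.Build _ _ _ _ _ meta2).
have := ge0_integral_pushforward meta1 m1 measurableT mh (fun v _ => h0 v).
have := ge0_integral_pushforward meta2 m2 measurableT mh (fun v _ => h0 v).
rewrite !preimage_setT /comp => <- <-.
apply: eq_measure_integral => A mA _.
apply: (@measure_unique _ R family cylinders (fun=> setT) _ _ _ _
  (pushforward m1 X1) (pushforward m2 X2)) => //.
- exact: cylinders_setI.
- move=> _; exists (fun=> setT) => //.
  by apply/seteqP; split.
- by rewrite bigcup_const.
- by move=> _ [B mB <-]; exact: E.
Qed.

End cylinders.
Arguments family K {d} U.

Section efron_stein.
Local Open Scope ereal_scope.
Context {d} {T : measurableType d} {R : realType} {P : probability T R}
  {I : finType} {d'} {U : measurableType d'} (xi : I -> {RV P >-> U}).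
Hypothesis xi_indep : forall A : I -> set U, (forall k, measurable (A k)) ->
  P (\bigcap_(k in setT) (xi k @^-1` A k)) = \prod_k P (xi k @^-1` A k).
Variables (f : family I U -> R) (mf : measurable_fun setT f).

(** The two factors of [P \x P] carry the variables and an independent copy; the coordinates in [J]
    are resampled from the copy. *)
Definition mix (J : {set I}) (w : T * T) : family I U :=
  fun k => xi k (if k \in J then w.2 else w.1).

Definition mix_dist (J J' : {set I}) : \bar R :=
  \int[P \x P]_w ((f (mix J w) - f (mix J' w)) ^+ 2)%:E.

Definition sym_diff (J S : {set I}) : {set I} :=
  [set k | (k \in J) (+) (k \in S)]%SET.

(** All variables together with their copies, the two being exchanged at the coordinates in [S]. By
    independence the law does not depend on [S]. *)
Let pair (S : {set I}) (w : T * T) : family (I * bool)%type U :=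
  fun kb => xi kb.1 (if (kb.1 \in S) (+) kb.2 then w.2 else w.1).

Let measurable_pair S : measurable_fun setT (pair S).
Proof.
apply: (@measurable_family _ _ _ _ _
  (fun kb w => xi kb.1 (if (kb.1 \in S) (+) kb.2 then w.2 else w.1))) => -[k b] /=.
by case: (_ (+) _); exact: measurableT_comp.
Qed.

Let P2oo : (P \x P) setT < +oo.
Proof.
rewrite -setXTT product_measure1E//.
by rewrite [X in X * _](probability_setT P) mul1e [X in X < _](probability_setT P) ltry.
Qed.

Let pair_law S (A : I * bool -> set U) : (forall k, measurable (A k)) ->
  (P \x P) (pair S @^-1` cylinder A)
    = \prod_k (P (xi k @^-1` A (k, false)) * P (xi k @^-1` A (k, true))).
Proof.
move=> mA.
have mX (B : I -> set U) : (forall k, measurable (B k)) ->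
    measurable (\bigcap_(k in setT) (xi k @^-1` B k)).
  move=> mB; apply: fin_bigcap_measurable; first exact: finite_finset.
  by move=> k _; rewrite -[X in measurable X]setTI; exact: measurable_funP.
rewrite (_ : _ @^-1` _ = (\bigcap_(k in setT) (xi k @^-1` A (k, k \in S))) `*`
    (\bigcap_(k in setT) (xi k @^-1` A (k, k \notin S)))); last first.
  apply/seteqP; split=> [[w1 w2] h|[w1 w2] [/= h1 h2] [k b]] /=.
    by split=> k _ /=; [have := h (k, k \in S)|have := h (k, k \notin S)];
      rewrite /pair /=; case: (k \in S).
  rewrite /pair /=; have := h1 k Logic.I; have := h2 k Logic.I.
  by case: (k \in S); case: b.
rewrite product_measure1E; [|exact: mX..].
transitivity ((\prod_k P (xi k @^-1` A (k, k \in S))) *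
    \prod_k P (xi k @^-1` A (k, k \notin S))).
  congr (_ * _); exact: (xi_indep (A := fun k => A (k, _))).
rewrite -big_split/=; apply: eq_bigr => k _.
by case: (k \in S) => //=; rewrite muleC.
Qed.

(** Exchanging variables and copies on [S] turns [mix J] into [mix (sym_diff J S)] and preserves the
    joint law, by [pair_law]. *)
Lemma mix_dist_swap S J J' :
  mix_dist (sym_diff J S) (sym_diff J' S) = mix_dist J J'.
Proof.
pose sel (J0 : {set I}) (v : family (I * bool)%type U) : family I U := fun k => v (k, k \in J0).
have msel J0 : measurable_fun setT (sel J0).
  apply: (@measurable_family _ _ _ _ _ (fun k (v : family (I * bool)%type U) => v (k, k \in J0))).
  by move=> k; exact: measurable_coord.
pose h v := ((f (sel J v) - f (sel J' v)) ^+ 2)%:E.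
have mh : measurable_fun setT h.
  apply/measurable_EFinP; apply: measurable_funX; apply: measurable_funB;
    exact: measurableT_comp.
have h0 v : 0 <= h v by rewrite lee_fin sqr_ge0.
transitivity (\int[P \x P]_w h (pair S w)).
  apply: eq_integral => -[w1 w2] _; rewrite /h; congr (((f _ - f _) ^+ 2)%:E);
  by apply/funext => k; rewrite /mix /sel /pair /= inE addbC.
transitivity (\int[P \x P]_w h (pair finset.set0 w)).
  apply: (integral_family_eq_law P2oo (measurable_pair S)
    (measurable_pair finset.set0) _ mh h0) => A mA.
  exact: etrans (pair_law _ mA) (esym (pair_law _ mA)).
apply: eq_integral => -[w1 w2] _; rewrite /h; congr (((f _ - f _) ^+ 2)%:E);
by apply/funext => k; rewrite /mix /sel /pair /= inE.
Qed.


Let measurable_mix J : measurable_fun setT (mix J).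
Proof.
apply: (@measurable_family _ _ _ _ _
  (fun k w => xi k (if k \in J then w.2 else w.1))) => k /=.
by case: (k \in J); exact: measurableT_comp.
Qed.

Definition joint (t : T) : family I U := fun k => xi k t.

Lemma measurable_joint : measurable_fun setT joint.
Proof.
by apply: (@measurable_family _ _ _ _ _ xi) => k; exact: measurable_funP.
Qed.

Lemma integral_mix J (h : family I U -> \bar R) :
    measurable_fun setT h -> (forall v, 0 <= h v) ->
  \int[P \x P]_w h (mix J w) = \int[P]_t h (joint t).
Proof.
move=> mh h0; apply: (integral_family_eq_law P2oo (measurable_mix J)
  measurable_joint _ mh h0) => A mA.
rewrite (_ : mix J @^-1` _ = pair J @^-1` cylinder (fun kb => if kb.2 then setT else A kb.1)).
  rewrite [LHS]pair_law; last by case=> k []; [exact: measurableT|exact: mA].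
  rewrite (_ : joint @^-1` _ = \bigcap_(k in setT) (xi k @^-1` A k)).
    rewrite [RHS](xi_indep mA); apply: eq_bigr => k _ /=.
    by rewrite preimage_setT probability_setT mule1.
  by apply/seteqP; split=> t /= h1 k; [move=> _|]; exact: h1.
apply/seteqP; split=> -[w1 w2] /= h1.
  by move=> [k []]//=; have := h1 k; rewrite /mix /pair /= addbF.
by move=> k; have := h1 (k, false); rewrite /mix /pair /= addbF.
Qed.

(** In any quadrilateral of an L2 space the squared diagonals sum to at most the squared sides, the
    difference being the square of [a - b - c + e]. With vertices given by the empty set, [S],
    [sym_diff J S] and [J], [mix_dist_swap] makes the two diagonals equal and opposite sides equal,
    so everything appears twice. *)
Lemma mix_dist_sym_diff J S : mix_dist finset.set0 (sym_diff J S) <=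
  mix_dist finset.set0 J + mix_dist finset.set0 S.
Proof.
have sd0 S' : sym_diff finset.set0 S' = S' by apply/setP => k; rewrite !inE.
have sdK : sym_diff (sym_diff J S) S = J.
  by apply/setP => k; rewrite !inE -addbA addbb addbF.
have sdC : sym_diff S J = sym_diff J S by apply/setP => k; rewrite !inE addbC.
have mD J1 J2 : measurable_fun setT
    (fun w => ((f (mix J1 w) - f (mix J2 w)) ^+ 2)%:E).
  by apply/measurable_EFinP; apply: measurable_funX; apply: measurable_funB;
    exact: measurableT_comp.
have D0 J1 J2 w : 0 <= ((f (mix J1 w) - f (mix J2 w)) ^+ 2)%:E.
  by rewrite lee_fin sqr_ge0.
have E1 := mix_dist_swap S finset.set0 (sym_diff J S).
have E2 := mix_dist_swap S finset.set0 J.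
have E3 := mix_dist_swap J finset.set0 S.
rewrite !sd0 ?sdK ?sdC in E1 E2 E3.
set J1 := sym_diff J S in E1 E2 E3 *.
have : mix_dist finset.set0 J1 + mix_dist S J <=
    (mix_dist finset.set0 J + mix_dist finset.set0 S) + (mix_dist S J1 + mix_dist J J1).
  rewrite /mix_dist -!ge0_integralD//;
    try by [move=> w _; rewrite adde_ge0|exact: emeasurable_funD].
  apply: ge0_le_integral => //.
  - by move=> w _; rewrite adde_ge0.
  - exact: emeasurable_funD.
  - by apply: emeasurable_funD; exact: emeasurable_funD.
  move=> w _; rewrite -!EFinD lee_fin.
  set a := f (mix finset.set0 w); set b := f (mix S w); set c := f (mix J w).
  set e := f (mix J1 w); rewrite -subr_ge0.
  suff -> : ((a - c) ^+ 2 + (a - b) ^+ 2 + ((b - e) ^+ 2 + (c - e) ^+ 2) -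
    ((a - e) ^+ 2 + (b - c) ^+ 2) = (a - b - (c - e)) ^+ 2)%R by exact: sqr_ge0.
  by ring.
rewrite E1 E2 E3; apply: contraTT; rewrite -!ltNge => lt.
by apply: lteD.
Qed.

Section blocks.
Variables (n : nat) (b : I -> 'I_n).

Let block (i : nat) : {set I} := [set k | b k == i :> nat]%SET.

(** Blocks are disjoint, so adding one to the resampled set is a symmetric difference, and the costs
    add up by induction on the number of blocks. *)
Lemma mix_dist_blocks : mix_dist finset.set0 [set: I]%SET <=
  \sum_(i < n) mix_dist finset.set0 (block i).
Proof.
have -> : [set: I]%SET = [set k | (b k < n)%N]%SET.
  by apply/setP => k; rewrite !inE ltn_ord.
rewrite -(big_mkord predT (fun i => mix_dist finset.set0 (block i))).
suff H m : mix_dist finset.set0 [set k | (b k < m)%N]%SET <=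
    \sum_(0 <= i < m) mix_dist finset.set0 (block i) by exact: H.
elim: m => [|m IH].
  rewrite big_geq// [X in mix_dist _ X](_ : _ = finset.set0); last first.
    by apply/setP => k; rewrite !inE.
  rewrite /mix_dist; under eq_integral do rewrite subrr expr0n /=.
  by rewrite integral0.
rewrite big_nat_recr//=; apply: le_trans (leeD IH (lexx _)).
rewrite [X in mix_dist _ X](_ : _ = sym_diff [set k | (b k < m)%N]%SET (block m)).
  exact: mix_dist_sym_diff.
by apply/setP => k; rewrite !inE ltnS; case: ltngtP.
Qed.

(** As [fi] does not see block [i], it can be subtracted from both values of [f]. The 4 is [2 * 2]:
    [(a - b)^2 <= 2 a^2 + 2 b^2], and both mixtures have the law of [joint]. *)
Lemma mix_dist_block (i : 'I_n) (fi : family I U -> R) :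
    measurable_fun setT fi ->
    (forall v v' : family I U, (forall k, b k != i -> v k = v' k) -> fi v = fi v') ->
  mix_dist finset.set0 (block i) <=
    4%:E * \int[P]_t ((f (joint t) - fi (joint t)) ^+ 2)%:E.
Proof.
move=> mfi fiE.
pose h v := ((f v - fi v) ^+ 2)%:E.
have mh : measurable_fun setT h.
  by apply/measurable_EFinP; apply: measurable_funX; apply: measurable_funB.
have h0 v : 0 <= h v by rewrite lee_fin sqr_ge0.
have hE J := integral_mix J mh h0.
have -> : 4%:E * \int[P]_t h (joint t) =
    2%:E * (\int[P \x P]_w h (mix finset.set0 w) + \int[P \x P]_w h (mix (block i) w)).
  rewrite !hE -[X in _ = 2%:E * (X + X)]mul1e -ge0_muleDl ?lee_fin// muleA -EFinD -EFinM.
  by congr (_%:E * _); ring.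
rewrite -ge0_integralD//; [|exact: measurableT_comp..].
rewrite -ge0_integralZl//; last 2 first.
- by apply: emeasurable_funD; exact: measurableT_comp.
- by move=> w _; rewrite adde_ge0.
apply: ge0_le_integral => //.
- by move=> w _; rewrite lee_fin sqr_ge0.
- by apply/measurable_EFinP; apply: measurable_funX; apply: measurable_funB;
    exact: measurableT_comp.
- by apply: measurable_funeM; apply: emeasurable_funD; exact: measurableT_comp.
move=> w _; rewrite /h.
have <- : fi (mix finset.set0 w) = fi (mix (block i) w).
  by apply: fiE => k ki; rewrite /mix !inE (inj_eq val_inj) (negbTE ki).
rewrite -EFinD -EFinM lee_fin.
set x := f _; set y := f _; set z := fi _; rewrite -subr_ge0.
suff -> : (2 * ((x - z) ^+ 2 + (y - z) ^+ 2) - (x - y) ^+ 2 = (x + y - 2 * z) ^+ 2)%R.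
  exact: sqr_ge0.
by ring.
Qed.

End blocks.

Lemma variance_le_sqr_dist (X : T -> R) (c : R) : X \in Lfun P 2%:E ->
  'V_P[X] <= \int[P]_t ((X t - c) ^+ 2)%:E.
Proof.
move=> X2; have Xc2 : (X \- cst c)%R \in Lfun P 2%:E.
  rewrite -[(X \- cst c)%R]/(X \+ cst (- c))%R rpredD ?lee1n// => ?; exact: Lfun_cst.
rewrite -(varianceB_cst_r c X2) (varianceE Xc2) unlock.
rewrite [leRHS](_ : _ = \int[P]_t (((X \- cst c) ^+ 2)%R t)%:E)//.
by rewrite geeDl// oppe_le0 sqre_ge0.
Qed.

Lemma efron_stein (n : nat) (b : I -> 'I_n) (fi : 'I_n -> family I U -> R) :
    (forall i, measurable_fun setT (fi i)) ->
    (forall i (v v' : family I U),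
      (forall k, b k != i -> v k = v' k) -> fi i v = fi i v') ->
    (fun t => f (joint t)) \in Lfun P 2%:E ->
  'V_P[fun t => f (joint t)] <=
    4%:E * \sum_(i < n) \int[P]_t ((f (joint t) - fi i (joint t)) ^+ 2)%:E.
Proof.
move=> mfi fiE f2.
apply: (@le_trans _ _ (mix_dist finset.set0 [set: I]%SET)).
  (* With the second copy fixed, the integral over the first one is a mean squared distance to the
     constant [f (joint t)], hence at least the variance. *)
  rewrite /mix_dist fubini_tonelli2//=; last 2 first.
  - apply/measurable_EFinP; apply: measurable_funX; apply: measurable_funB;
      exact: measurableT_comp.
  - by move=> w; rewrite lee_fin sqr_ge0.
  rewrite -[leLHS]mule1 -(probability_setT P) -integral_cst//.
  apply: ge0_le_integral => //.
  - by move=> t _; exact: variance_ge0.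
  - apply: (measurable_fun_fubini_tonelli_G (fun w => ((f (mix finset.set0 w) -
      f (mix [set: I]%SET w)) ^+ 2)%:E)).
      apply/measurable_EFinP; apply: measurable_funX; apply: measurable_funB;
        exact: measurableT_comp.
    by move=> w; rewrite lee_fin sqr_ge0.
  move=> t _; apply: le_trans (variance_le_sqr_dist (f (joint t)) f2) _.
  rewrite le_eqVlt; apply/orP; left; apply/eqP; apply: eq_integral => t' _.
  by congr ((f _ - f _) ^+ 2)%:E; apply/funext => k; rewrite /mix /joint inE.
apply: le_trans (mix_dist_blocks b) _.
rewrite ge0_sume_distrr; last first.
  by move=> i _; apply: integral_ge0 => t _; rewrite lee_fin sqr_ge0.
by apply: lee_sum => i _; apply: mix_dist_block; [exact: mfi|exact: fiE].
Qed.

End efron_stein.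

(** * Truncated second moments *)

Section geometric.
Context {R : realType}.

Lemma nneseries_geometric_le (c rho : R) (u : nat -> \bar R) :
    0 <= c -> 0 <= rho < 1 -> (forall k, 0 <= u k)%E ->
    (forall k, u k <= (c * rho ^+ k)%:E)%E ->
  (\sum_(k <oo) u k <= (c / (1 - rho))%:E)%E.
Proof.
move=> c0 /andP[rho0 rho1] u0 uc; apply: lime_le.
  by apply: is_cvg_nneseries => k _ _.
apply: nearW => m; apply: le_trans (lee_sum _ (fun k _ => uc k)) _.
rewrite sumEFin lee_fin -mulr_sumr ler_wpM2l// -[leRHS]div1r ler_pdivlMr ?subr_gt0//.
rewrite big_mkord mulrC -opprB mulNr -subrX1 opprB gerBl exprn_ge0//.
Qed.

Lemma dyadic_scale (y0 x : R) : 0 < y0 -> y0 < x ->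
  exists k : nat, 2 ^+ k * y0 < x <= 2 ^+ k.+1 * y0.
Proof.
move=> y00 xy.
have ex : exists m, x <= 2 ^+ m * y0.
  exists (Num.bound (x / y0)); rewrite -ler_pdivrMr//.
  apply: (le_trans (ltW (archi_boundP _))).
    by rewrite divr_ge0// ltW// (lt_trans y00).
  by rewrite -natrX ler_nat ltnW// ltn_expl.
case: (ex_minnP ex) => -[|m] xm mmin.
  by move: xm; rewrite expr0 mul1r leNgt xy.
exists m; rewrite xm andbT ltNge; apply/negP => /mmin.
by rewrite ltnn.
Qed.

Lemma powR_interpolate (u v w theta : R) : 0 <= theta <= 1 -> 0 <= u ->
  u <= v -> u <= w -> u <= v `^ (1 - theta) * w `^ theta.
Proof.
move=> /andP[t0 t1] u0 uv uw; have [->|un0] := eqVneq u 0.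
  by rewrite mulr_ge0// powR_ge0.
rewrite -{1}(powRr1 u0) -{1}(subrK theta 1) powRD ?un0 ?implybT//.
by apply: ler_pM; rewrite ?powR_ge0// ge0_ler_powR ?subr_ge0// ?nnegrE// (le_trans u0).
Qed.

End geometric.

Section second_moment.
Context {R : realType} (Fc : R -> R) (C x0 s : R).
Hypotheses (hC : 0 < C) (hx0 : 0 < x0).
Hypothesis htail : forall a x, 1 < a -> x0 < x -> Fc (a * x) <= C / a `^ s * Fc x.
Hypothesis Fc01 : forall x, 0 < x -> 0 <= Fc x <= 1.
Hypothesis Fc_mono : forall x y, 0 < x -> x <= y -> Fc y <= Fc x.

(** With [y0 = 2 * x0] and [theta = 2 / s1]: the summand 1 pays for weights between [L] and [y0],
    the quotient is the geometric series over the dyadic bands above [y0]. *)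
Definition moment_cst (s1 : R) : R := (2 * x0) ^+ 2 *
  (1 + 4 * Num.max C 1 `^ (2 / s1) / (1 - 4 * 2 `^ (- s * (2 / s1)))).

(** The ratio is 2 to the power [2 - 2 * s / s1], so [s1 < s] is what makes the series converge. *)
Lemma moment_ratio (s1 : R) : 2 < s1 < s -> 0 <= 4 * 2 `^ (- s * (2 / s1)) < 1.
Proof.
move=> /andP[s12 s1s]; have s10 : 0 < s1 by rewrite (lt_trans _ s12).
rewrite mulr_ge0 ?powR_ge0//=.
have -> : 4 = 2 `^ 2 :> R by rewrite -[2 in X in _ = X]/(2%:R) powR_mulrn// expr2; ring.
rewrite -powRD ?pnatr_eq0 ?implybT//.
rewrite /powR pnatr_eq0/= -[ltRHS]expR0 ltr_expR pmulr_llt0 ?ln_gt0 ?ltr1n//.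
by rewrite mulNr mulrA subr_lt0 ltr_pdivlMr// mulrC ltr_pM2r.
Qed.

Lemma moment_cst_ge0 (s1 : R) : 2 < s1 < s -> 0 <= moment_cst s1.
Proof.
move=> /moment_ratio/andP[_ rho1].
by rewrite mulr_ge0 ?sqr_ge0// addr_ge0// divr_ge0 ?subr_ge0 ?(ltW rho1)// mulr_ge0// powR_ge0.
Qed.

(** The scale starts at [2 * x0] because the tail condition needs [x > x0]. It also needs [a > 1],
    so [k = 0] is bounded by 1 instead, whence the maximum. *)
Lemma tail_dyadic (k : nat) :
  Fc (2 ^+ k * (2 * x0)) <= Num.max C 1 * 2 `^ (- s * k%:R).
Proof.
have y00 : 0 < 2 * x0 by rewrite mulr_gt0.
case: k => [|k].
  rewrite expr0 mul1r mulr0 powRr0 mulr1 (@le_trans _ _ 1)//.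
    by have /andP[] := Fc01 y00.
  by rewrite le_max lexx orbT.
have a1 : 1 < 2 ^+ k.+1 :> R by rewrite exprn_egt1// ltr1n.
have xy : x0 < 2 * x0 by rewrite -{1}[x0]mul1r ltr_pM2r// ltr1n.
apply: le_trans (htail a1 xy) _.
have -> : (2 ^+ k.+1) `^ s = (2 `^ (- s * k.+1%:R))^-1 :> R.
  by rewrite -powR_mulrn// -powRrM -powRN mulNr opprK mulrC.
rewrite invrK -[leRHS]mulr1 ler_pM//.
- by rewrite mulr_ge0 ?powR_ge0// ltW.
- by have /andP[] := Fc01 y00.
- by rewrite ler_wpM2r ?powR_ge0// le_max lexx.
- by have /andP[] := Fc01 y00.
Qed.

Context {d} {T : measurableType d} {P : probability T R} (W : {RV P >-> R}).
Hypothesis W0 : forall t, 0 < W t.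

Definition exceed (y : R) : set T := W @^-1` `]y, +oo[.

(** Splitting the range of [W] dyadically leaves tails at [Y k], the larger of [L] and
    [2 ^+ k * y0]. Each is at most [Fc L] and at most the dyadic tail; interpolating with exponents
    [1 - theta] and [theta] takes smallness from the first bound and summability from the second.
    [E] stands for an event of the graph, independent of the weight. *)
Lemma second_moment_le (E : set T) (L s1 : R) : measurable E ->
    (forall y : R, (0 < y)%R -> P (exceed y `&` E) = P E * (Fc y)%:E)%E ->
    0 < L -> 2 < s1 < s ->
  (\int[P]_(t in E) ((W t) ^+ 2)%:E
    <= P E * (L ^+ 2 + moment_cst s1 * Fc L `^ (1 - 2 / s1))%:E)%E.
Proof.
move=> mE PE L0 /andP[s12 s1s].
set y0 := 2 * x0; have y00 : 0 < y0 by rewrite mulr_gt0.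
have s10 : 0 < s1 by rewrite (lt_trans _ s12).
set theta := 2 / s1.
have th : 0 <= theta <= 1.
  by apply/andP; split; [rewrite divr_ge0// ltW|rewrite ler_pdivrMr// mul1r ltW].
set rho := 4 * 2 `^ (- s * theta).
have rho01 : 0 <= rho < 1 by apply: moment_ratio; rewrite s12.
set Fth := Fc L `^ (1 - theta).
have Fth0 : 0 <= Fth by rewrite powR_ge0.
have mA y : measurable (exceed y).
  by rewrite -[exceed y]setTI; exact: measurable_funP.
have mAE y : measurable_fun E (fun t => (\1_(exceed y) t)%:E : \bar R).
  by apply/measurable_EFinP; exact: measurable_indic.
have PA y : 0 < y -> (\int[P]_(t in E) (\1_(exceed y) t)%:E = P E * (Fc y)%:E)%E.
  move=> y_gt0; rewrite integral_indic//; exact: PE.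
(* The squared upper end of the band from [2 ^+ k * y0] to [2 ^+ k.+1 * y0]. *)
pose c k : R := 4 ^+ k.+1 * y0 ^+ 2.
have c0 k : 0 <= c k by rewrite mulr_ge0 ?exprn_ge0// ltW.
pose Y (k : nat) : R := Num.max (2 ^+ k * y0) L.
have Y0 k : 0 < Y k by rewrite lt_max L0 orbT.
have FcY k : Fc (Y k) <= Fth * (Num.max C 1 `^ theta * (2 `^ (- s * theta)) ^+ k).
  have /andP[FY0 _] := Fc01 (Y0 k).
  have h1 : Fc (Y k) <= Fc L.
    by apply: Fc_mono => //; rewrite le_max lexx orbT.
  have h2 : Fc (Y k) <= Fc (2 ^+ k * y0).
    by apply: Fc_mono; [rewrite mulr_gt0 ?exprn_gt0|rewrite le_max lexx].
  apply: le_trans (powR_interpolate th FY0 h1 (le_trans h2 (tail_dyadic k))) _.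
  rewrite powRM ?powR_ge0 ?le_max ?ler01 ?orbT//.
  by rewrite -powRrM -powR_mulrn ?powR_ge0// -powRrM mulrAC.
(* A pointwise majorant of the squared weight: its terms cover weights up to [L], weights between
   [L] and [y0], and the dyadic bands. *)
pose g t : \bar R := ((L ^+ 2)%:E + (y0 ^+ 2)%:E * (\1_(exceed L) t)%:E +
  \sum_(k <oo) (c k)%:E * (\1_(exceed (Y k)) t)%:E)%E.
have term0 y (a : R) t : 0 <= a -> (0 <= a%:E * (\1_(exceed y) t)%:E)%E.
  by move=> a0; rewrite -EFinM lee_fin mulr_ge0.
have series0 t : (0 <= \sum_(k <oo) (c k)%:E * (\1_(exceed (Y k)) t)%:E)%E.
  by apply: nneseries_ge0 => k _ _; exact: term0.
have mterm y (a : R) : measurable_fun E (fun t => a%:E * (\1_(exceed y) t)%:E)%E.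
  exact: measurable_funeM.
have mseries : measurable_fun E
    (fun t => \sum_(k <oo) (c k)%:E * (\1_(exceed (Y k)) t)%:E)%E.
  by apply: ge0_emeasurable_sum => // k t _ _; exact: term0.
have mW : measurable_fun E (fun t => ((W t) ^+ 2)%:E : \bar R).
  apply/measurable_EFinP; apply: measurable_funX.
  exact: measurable_funTS.
apply: (@le_trans _ _ (\int[P]_(t in E) g t)%E).
  apply: ge0_le_integral => //.
  - by move=> t _; rewrite lee_fin sqr_ge0.
  - by apply: emeasurable_funD => //; apply: emeasurable_funD.
  move=> t _; rewrite /g.
  have [WL|LW] := leP (W t) L.
    rewrite -addeA; apply: (@le_trans _ _ (L ^+ 2)%:E).
      by rewrite lee_fin lerXn2r// ?nnegrE ltW.
    by rewrite leeDl//; apply: adde_ge0 => //; apply: term0; exact: sqr_ge0.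
  have [Wy|yW] := leP (W t) y0.
    apply: (@le_trans _ _ ((L ^+ 2)%:E + (y0 ^+ 2)%:E * (\1_(exceed L) t)%:E)%E);
      last by rewrite leeDl.
    rewrite indicE mem_set ?mule1; last by rewrite /exceed /= in_itv/= LW.
    rewrite -EFinD lee_fin -[leLHS]add0r lerD// ?sqr_ge0//.
    by rewrite lerXn2r// ?nnegrE ltW.
  have [k /andP[kW Wk]] := dyadic_scale y00 yW.
  apply: (@le_trans _ _ (\sum_(k <oo) (c k)%:E * (\1_(exceed (Y k)) t)%:E)%E);
    last by rewrite leeDr//; apply: adde_ge0;
      [rewrite lee_fin sqr_ge0|apply: term0; exact: sqr_ge0].
  apply: le_trans (nneseries_lim_ge k.+1 (fun i _ _ => term0 (Y i) (c i) t (c0 i))).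
  rewrite big_nat_recr//=.
  apply: (@le_trans _ _ ((c k)%:E * (\1_(exceed (Y k)) t)%:E)%E).
    rewrite indicE mem_set ?mule1; last first.
      by rewrite /exceed /= in_itv/= andbT /Y gt_max kW LW.
    have -> : c k = (2 ^+ k.+1 * y0) ^+ 2.
      rewrite /c (exprMn _ (2 ^+ k.+1)) -exprM mulnC exprM; congr (_ ^+ _ * _); ring.
    by rewrite lee_fin lerXn2r// nnegrE ltW// (lt_le_trans _ Wk).
  by rewrite leeDr//; apply: sume_ge0 => i _; exact: term0.
have y2 : 0 <= y0 ^+ 2 by rewrite sqr_ge0.
have L2 : 0 <= L ^+ 2 by rewrite sqr_ge0.
rewrite /g ge0_integralD//; [|by move=> t _; apply: adde_ge0 => //; exact: term0|exact: emeasurable_funD].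
rewrite ge0_integralD//; last by move=> t _; exact: term0.
rewrite integral_cst// ge0_integralZl//.
rewrite integral_nneseries//; last by move=> k t _; exact: term0.
rewrite PA//.
have PE0 : (0 <= P E)%E by [].
have PEfin : P E \is a fin_num by exact: fin_num_measure.
rewrite [X in ((L ^+ 2)%:E * X + _ + _ <= _)%E](_ : _ = P E)//.
rewrite -(fineK PEfin) in PA *; set q := fine (P E) in PA *.
have q0 : 0 <= q by exact: fine_ge0.
set Cth := Num.max C 1 `^ theta in FcY *.
have Cth0 : 0 <= Cth by exact: powR_ge0.
have ser : (\sum_(k <oo) \int[P]_(t in E) ((c k)%:E * (\1_(exceed (Y k)) t)%:E)
    <= ((4 * y0 ^+ 2 * q * Fth * Cth) / (1 - rho))%:E)%E.
  apply: nneseries_geometric_le => //.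
  - by do 4! apply: mulr_ge0 => //.
  - by move=> k; apply: integral_ge0 => t _; exact: term0.
  move=> k; rewrite ge0_integralZl ?lee_fin//.
  rewrite PA// -!EFinM lee_fin.
  have cq0 : 0 <= c k * q by rewrite mulr_ge0.
  rewrite mulrA; apply: le_trans (ler_wpM2l cq0 (FcY k)) _.
  by rewrite /c /rho (exprMn _ 4) (exprS 4) le_eqVlt; apply/orP; left; apply/eqP; ring.
apply: le_trans (leeD (lexx _) ser) _.
have F1 : Fc L <= Fth.
  have /andP[F0 Fle1] := Fc01 L0.
  have -> : Fth = Fth * 1 `^ theta by rewrite powR1 mulr1.
  exact: powR_interpolate.
rewrite -!EFinM -!EFinD lee_fin /moment_cst -/theta -/rho -/y0 -/Cth.
have := ler_wpM2l (mulr_ge0 y2 q0) F1.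
set e := (1 - rho)^-1; set z := y0 ^+ 2 => h.
rewrite -subr_ge0.
suff -> : q * (L ^+ 2 + z * (1 + 4 * Cth * e) * Fth) -
    (L ^+ 2 * q + z * (q * Fc L) + 4 * z * q * Fth * Cth * e)
    = z * q * Fth - z * q * Fc L by rewrite subr_ge0.
by ring.
Qed.
End second_moment.

(** * Measurability and independence of the random graph *)

Section finite_range.
Context {d} {T : measurableType d} {S : finType}.

Lemma measurable_implyb (c : bool) (b : T -> bool) :
  measurable [set t | b t] -> measurable [set t | c ==> b t].
Proof.
case: c => //= _; rewrite (_ : [set t | _] = setT)//.
by apply/seteqP; split.
Qed.

Lemma measurable_forallb (b : S -> T -> bool) :
  (forall i, measurable [set t | b i t]) -> measurable [set t | [forall i, b i t]].
Proof.
move=> mb; rewrite (_ : [set t | _] = \bigcap_(i in setT) [set t | b i t]).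
  by apply: fin_bigcap_measurable => //; exact: finite_finset.
by apply/seteqP; split=> t /= h; [move=> i _; exact: (forallP h)|apply/forallP => i; exact: h].
Qed.

Lemma measurable_fibers (F : T -> S) (phi : pred S) :
  (forall x, measurable [set t | F t = x]) -> measurable [set t | phi (F t)].
Proof.
move=> mF; rewrite (_ : [set t | _] = \bigcup_(x in [set x | phi x]) [set t | F t = x]).
  by apply: fin_bigcup_measurable => //; exact: finite_finset.
by apply/seteqP; split=> t /=; [exists (F t)|case=> x /= ? ->].
Qed.

Lemma measure_fibers {R : realType} (m : {measure set T -> \bar R}) (F : T -> S)
    (A : set T) : measurable A -> (forall x, measurable [set t | F t = x]) ->
  (m A = \sum_x m (A `&` [set t | F t = x]))%E.
Proof.
move=> mA mF; rewrite -[in LHS](setIT A).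
rewrite (_ : A `&` setT = \bigcup_(x in setT) (A `&` [set t | F t = x])); last first.
  by apply/seteqP; split=> t /=; [case=> At _; exists (F t)|case=> x _ []].
have triv : trivIset [set: S] (fun x => A `&` [set t | F t = x]).
  move=> x y _ _ [t [[_ /= <-] [_ /= <-]]] //.
have mA' x : [set: S] x -> measurable (A `&` [set t | F t = x]).
  by move=> _; exact: measurableI.
rewrite (measure_fin_bigcup m finite_finset triv mA').
rewrite (_ : [set: S] = [set` index_enum S]).
  by rewrite -fsbig_seq// index_enum_uniq.
by apply/seteqP; split=> x //= _; exact: mem_index_enum.
Qed.

Lemma measure_le_sum {R : realType} (m : {measure set T -> \bar R}) (A : set T)
    (B : S -> set T) : measurable A -> (forall i, measurable (B i)) ->
  A `<=` \bigcup_i B i -> (m A <= \sum_i m (B i))%E.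
Proof.
move=> mA mB AB.
have H (s : seq S) : measurable (\big[setU/set0]_(i <- s) B i) /\
    (m (\big[setU/set0]_(i <- s) B i) <= \sum_(i <- s) m (B i))%E.
  elim: s => [|x s [mIH IH]]; first by rewrite !big_nil measure0.
  rewrite !big_cons; split; first exact: measurableU.
  exact: le_trans (measureU2 _ _ _) (leeD _ _).
have [mU mle] := H (index_enum S); apply: le_trans mle.
apply: le_measure; rewrite ?inE//; apply: subset_trans AB _.
rewrite -bigcup_seq => t [i _ Bt]; exists i => //=; exact: mem_index_enum.
Qed.

End finite_range.

Section measurability.
Context {R : realType} {d} {T : measurableType d} {n : nat}.

Lemma measurable_euclidean_dist_lt (r : R) (x y : T -> R * R) :
  measurable_fun setT x -> measurable_fun setT y ->
  measurable [set t | euclidean_dist (x t) (y t) < r].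
Proof.
move=> mx my; rewrite -[X in measurable X]setTI.
have m1 (w : T -> R * R) : measurable_fun setT w -> measurable_fun setT (fun t => (w t).1).
  by move=> mw; exact: measurableT_comp.
have m2 (w : T -> R * R) : measurable_fun setT w -> measurable_fun setT (fun t => (w t).2).
  by move=> mw; exact: measurableT_comp.
have := @measurable_fun_ltr _ T R setT (fun t => euclidean_dist (x t) (y t)) (cst r).
move=> /(_ _ _ measurableT [set true])/=; apply => //.
rewrite /euclidean_dist.
apply: measurableT_comp.
  apply: continuous_measurable_fun; exact: sqrt_continuous.
apply: measurable_funD; apply: measurable_funX; apply: measurable_funB; auto.
Qed.

(** The domain is arbitrary because the lemma is applied to the sample space, to the sigma-algebra
    generated by the locations alone, and to the space of coordinate families. *)
Lemma measurable_rgg (r : R) (z : edge n -> T -> bool) (x : 'I_n -> T -> R * R)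
    (phi : pred {set edge n}) :
    (forall e, measurable_fun setT (z e)) ->
    (forall i, measurable_fun setT (x i)) ->
  measurable [set t | phi (rgg r (z^~ t) (x^~ t))].
Proof.
move=> mz mx.


have me e : measurable [set t | e \in rgg r (z^~ t) (x^~ t)].
  rewrite (_ : [set t | _] = z e @^-1` [set true] `&` [set t | [forall u, [forall v,
     (u \in val e) ==> ((v \in val e) ==> ((u != v) ==> (euclidean_dist (x u t) (x v t) < r)))]]]).
    apply: measurableI; first by rewrite -[X in measurable X]setTI; exact: mz.
    apply: measurable_forallb => u; apply: measurable_forallb => v.
    do 3 apply: measurable_implyb.
    exact: measurable_euclidean_dist_lt.
  apply/seteqP; split=> t /=; rewrite inE.
    move=> /andP[ze /forall_inP h]; split=> //; apply/forallP => u; apply/forallP => v.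
    by apply/implyP => ue; apply/implyP => ve; apply: (forall_inP (h u ue)).
  move=> [-> /forallP h] /=; apply/forall_inP => u ue; apply/forall_inP => v ve.
  by have /forallP/(_ v) := h u; rewrite ue ve.
apply: measurable_fibers => G.
rewrite (_ : [set t | _] = [set t | [forall e, (e \in rgg r (z^~ t) (x^~ t)) == (e \in G)]]).
  apply: measurable_forallb => e; case: (e \in G).
    by rewrite (_ : [set t | _] = [set t | e \in rgg r (z^~ t) (x^~ t)])//;
      apply/seteqP; split=> t /=; rewrite eqb_id.
  rewrite (_ : [set t | _] = ~` [set t | e \in rgg r (z^~ t) (x^~ t)]).
    exact: measurableC.
  by apply/seteqP; split=> t /=; rewrite eqbF_neg => /negP.
apply/seteqP; split=> t /= => [->|/forallP h]; first by apply/forallP.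
by apply/setP => e; exact/eqP/h.
Qed.

End measurability.

Section sigma_algebras.
Context {R : realType} {d} {Omega : measurableType d} {P : probability Omega R}.

(** A measurable type whose measurable sets are those of [family_sigma Y], so that general
    measurability lemmas prove membership there. *)
Definition generated {I : finType} {d'} {U : measurableType d'}
    (Y : I -> {RV P >-> U}) : measurableType _ :=
  g_sigma_algebraType (\bigcup_i preimage_sigma (Y i)).

Lemma measurable_generated {I : finType} {d'} {U : measurableType d'}
    (Y : I -> {RV P >-> U}) i : measurable_fun setT (Y i : generated Y -> U).
Proof.
by move=> _ A mA; apply: sub_sigma_algebra; exists i => //; exists A.
Qed.

Lemma family_sigmaT {I : finType} {d'} {U : measurableType d'}
    (Y : I -> {RV P >-> U}) : family_sigma Y setT.
Proof. exact: (@measurableT _ (generated Y)). Qed.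

Lemma mutually_independentP {I : finType} {d'} {U : measurableType d'}
    (Y : I -> {RV P >-> U}) : mutually_independent Y ->
  forall (J : {set I}) (A : I -> set U), (forall i, measurable (A i)) ->
  (P (\bigcap_(i in [set` J]) (Y i @^-1` A i)) = \prod_(i in J) P (Y i @^-1` A i))%E.
Proof.
by move=> hY J A mA; apply: hY => i _; exists (A i) => //; rewrite setTI.
Qed.

Lemma mutually_independent_setT {I : finType} {d'} {U : measurableType d'}
    (Y : I -> {RV P >-> U}) : mutually_independent Y ->
  forall A : I -> set U, (forall i, measurable (A i)) ->
  (P (\bigcap_i (Y i @^-1` A i)) = \prod_i P (Y i @^-1` A i))%E.
Proof.
move=> hY A mA; have := mutually_independentP hY [set: I]%SET mA.
rewrite (_ : [set` [set: I]%SET] = setT); last first.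
  by apply/seteqP; split=> i //= _; rewrite inE.
by move=> ->; apply: eq_bigl => i; rewrite inE.
Qed.

Lemma family_sigma_bigcap {I : finType} {d'} {U : measurableType d'}
    (Y : I -> {RV P >-> U}) (D : set I) (A : I -> set U) :
  (forall i, measurable (A i)) -> family_sigma Y (\bigcap_(i in D) (Y i @^-1` A i)).
Proof.
move=> mA; apply: (@fin_bigcap_measurable _ (generated Y)) => // i _.
by rewrite -[X in measurable X]setTI; exact: measurable_generated.
Qed.

Lemma family_sigma_measurable {I : finType} {d'} {U : measurableType d'}
    (Y : I -> {RV P >-> U}) A : family_sigma Y A -> measurable A.
Proof.
apply: smallest_sub; first exact: sigma_algebra_measurable.
by move=> B [i _ [C mC <-]]; exact: measurable_funP.
Qed.

End sigma_algebras.

Section model.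
Context {R : realType} {f : R * R -> R} {Fc : R -> R} {d}
  {Omega : measurableType d} {P : probability Omega R} {n : nat} {p : R}
  {Z : edge n -> {RV P >-> bool}} {W : edge n -> {RV P >-> R}}
  {X : 'I_n -> {RV P >-> (R * R)%type}}.
Hypothesis model : bernoulli_rgg_model f Fc p Z W X.
Variable r : R.

Definition graph (t : Omega) : {set edge n} :=
  rgg r (fun e => Z e t) (fun i => X i t).

Lemma measurable_graph (phi : pred {set edge n}) :
  measurable [set t | phi (graph t)].
Proof.
apply: (@measurable_rgg _ _ _ _ r (fun e t => Z e t) (fun i t => X i t)) => ?;
  exact: measurable_funP.
Qed.

Lemma measure_exceed e (y : R) : 0 < y -> P (exceed (W e) y) = (Fc y)%:E.
Proof. by move=> y0; have := weight_law model e y0. Qed.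

Lemma indep_states_locations (A C : set Omega) :
  family_sigma Z A -> family_sigma X C -> (P (A `&` C) = P A * P C)%E.
Proof.
move=> ZA XC; have := families_indep model ZA (@family_sigmaT _ _ _ _ _ _ _ W) XC.
by rewrite setIT probability_setT mule1.
Qed.

(** The graph depends on two of the three independent families. Once the finite configuration [z] of
    states is fixed, the event concerns the locations only, so the triple product rule applies for
    each [z], and the results are summed. *)
Lemma indep_graph_weight (phi : pred {set edge n}) e (y : R) : 0 < y ->
  (P (exceed (W e) y `&` [set t | phi (graph t)])
    = P [set t | phi (graph t)] * (Fc y)%:E)%E.
Proof.
move=> y0; rewrite -(measure_exceed e y0).
pose F t := [set e | Z e t]%SET.
pose C (z : {set edge n}) := [set t | phi (rgg r (fun e => e \in z) (fun i => X i t))].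
have ZF z : family_sigma Z [set t | F t = z].
  rewrite (_ : [set t | _] = \bigcap_(e in setT) (Z e @^-1` [set e \in z])).
    exact: family_sigma_bigcap.
  apply/seteqP; split=> t /=; first by move=> <- e' _ /=; rewrite inE.
  by move=> h; apply/setP => e'; rewrite inE; exact: h.
have XC z : family_sigma X (C z).
  have h := @measurable_rgg _ _ (generated X) n r (fun e' _ => e' \in z)
    (fun i t => X i t) phi (fun _ => measurable_cst _) (@measurable_generated _ _ _ _ _ _ _ X).
  exact: h.
have WD : family_sigma W (exceed (W e) y).
  rewrite (_ : exceed (W e) y = \bigcap_(e' in [set e]) (W e' @^-1` `]y, +oo[)).
    exact: family_sigma_bigcap.
  by rewrite bigcap_set1.
have mF z : measurable [set t | F t = z] := family_sigma_measurable (ZF z).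
have EC z : [set t | phi (graph t)] `&` [set t | F t = z] = [set t | F t = z] `&` C z.
  have h t : F t = z -> graph t = rgg r (fun e => e \in z) (fun i => X i t).
    by move=> <-; rewrite /graph; congr rgg; apply/funext => e'; rewrite inE.
  by rewrite setIC; apply/seteqP; split=> t /= [Ft]; rewrite /C /= (h _ Ft).
have mE := measurable_graph phi.
have mD := family_sigma_measurable WD.
rewrite (measure_fibers P (measurableI _ _ mD mE) mF) (measure_fibers P mE mF).
rewrite ge0_sume_distrl//; apply: eq_bigr => z _.
rewrite -setIA EC setIA [exceed _ _ `&` _]setIC.
apply: etrans (families_indep model (ZF z) WD (XC z)) _.
by rewrite [X in (_ = X * _)%E](indep_states_locations (ZF z) (XC z)) muleAC.
Qed.

End model.

(** * Locations and neighbourhoods *)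

Section rectangles.
Context {R : realType}.

Definition rectangle (a b c e : R) : set (R * R) := `[a, b] `*` `[c, e].

Lemma measurable_rectangle a b c e : measurable (rectangle a b c e).
Proof. exact: measurableX. Qed.

Lemma lebesgue2_rectangle a b c e : a <= b -> c <= e ->
  lebesgue2 (rectangle a b c e) = ((b - a) * (e - c))%:E.
Proof.
move=> ab ce.
transitivity (@lebesgue_measure R `[a, b]%classic * @lebesgue_measure R `[c, e]%classic)%E.
  exact: product_measure1E.
rewrite !lebesgue_measure_itv/= !lte_fin.
have h (x y : R) : x <= y ->
    (if (x < y)%R then y%:E - x%:E else 0)%E = (y - x)%:E.
  by rewrite le_eqVlt => /orP[/eqP ->|->]; rewrite ?ltxx ?subrr.
by rewrite !h// EFinM.
Qed.

Lemma unit_squareE : @unit_square R = rectangle 0 1 0 1.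
Proof. by []. Qed.

Lemma measurable_unit_square : measurable (@unit_square R).
Proof. exact: measurable_rectangle. Qed.

End rectangles.

Section locations.
Context {R : realType} {eps1 eps2 : R} {f : R * R -> R} {Fc : R -> R} {d}
  {Omega : measurableType d} {P : probability Omega R} {n : nat} {p : R}
  {Z : edge n -> {RV P >-> bool}} {W : edge n -> {RV P >-> R}}
  {X : 'I_n -> {RV P >-> (R * R)%type}}.
Hypothesis heps1 : 0 < eps1.
Hypothesis hf : density_on_square f.
Hypothesis hfeps : forall x, unit_square x -> eps1 <= f x <= eps2.
Hypothesis model : bernoulli_rgg_model f Fc p Z W X.

Let mf (A : set (R * R)) : A `<=` @unit_square R -> measurable_fun A (fun x => (f x)%:E).
Proof.
move=> AS; apply/measurable_EFinP; apply: (measurable_funS _ AS).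
  exact: measurable_unit_square.
by case: hf.
Qed.

Let f0 x : unit_square x -> (0 <= (f x)%:E)%E.
Proof. by move=> /hfeps/andP[h _]; rewrite lee_fin (le_trans (ltW heps1)). Qed.

Lemma location_in_square i : (P (X i @^-1` @unit_square R) = 1)%E.
Proof.
rewrite (location_law model); last exact: measurable_unit_square.
by rewrite setIid; case: hf.
Qed.

Lemma location_rectangle_le i (a b c e : R) : 0 <= eps2 -> a <= b -> c <= e ->
  (P (X i @^-1` rectangle a b c e) <= (eps2 * ((b - a) * (e - c)))%:E)%E.
Proof.
move=> e20 ab ce; rewrite (location_law model); last exact: measurable_rectangle.
set A := _ `&` _.
have mA : measurable A.
  by apply: measurableI; [exact: measurable_rectangle|exact: measurable_unit_square].
apply: (@le_trans _ _ (\int[@lebesgue2 R]_(x in A) (cst eps2%:E x))%E).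
  apply: ge0_le_integral => //.
  - by move=> x [_]; exact: f0.
  - by apply: mf => x [].
  - by move=> x [_ /hfeps/andP[_]]; rewrite lee_fin.
rewrite integral_cst// EFinM lee_wpmul2l ?lee_fin// -lebesgue2_rectangle//.
by apply: le_measure; rewrite ?inE; [exact: mA|exact: measurable_rectangle|exact: subIsetl].
Qed.

Lemma location_rectangle_ge i (a b c e : R) : a <= b -> c <= e ->
    rectangle a b c e `<=` @unit_square R ->
  ((eps1 * ((b - a) * (e - c)))%:E <= P (X i @^-1` rectangle a b c e))%E.
Proof.
move=> ab ce AS; rewrite (location_law model); last exact: measurable_rectangle.
rewrite setIidl//; have mA := measurable_rectangle a b c e.
apply: (@le_trans _ _ (\int[@lebesgue2 R]_(x in rectangle a b c e) (cst eps1%:E x))%E).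
  by rewrite integral_cst// EFinM -lebesgue2_rectangle.
apply: ge0_le_integral => //.
- by move=> x _; rewrite lee_fin ltW.
- exact: mf.
- by move=> x /AS/hfeps/andP[+ _]; rewrite lee_fin.
Qed.

Lemma location_preimage_eq i j (B : set (R * R)) : measurable B ->
  P (X i @^-1` B) = P (X j @^-1` B).
Proof. by move=> mB; rewrite !(location_law model). Qed.

End locations.

Section cells.
Context {R : realType}.

(** The 3 makes the diagonal [2 * sqrt 2 / K] of a 2 x 2 window less than [r]; rounding up adds 1,
    at most [1 / r], whence the 4. *)
Lemma cell_count (r : R) : 0 < r < 1 -> exists K : nat,
  (0 < K)%N /\ 3 / r <= K%:R <= 4 / r.
Proof.
move=> /andP[r0 r1]; exists (Num.truncn (3 / r)).+1; split=> //.
have h : 0 <= 3 / r by rewrite divr_ge0// ltW.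
have /andP[lo hi] := truncn_itv h.
rewrite ltW//= -natr1; apply: (le_trans (lerD lo (lexx 1))).
rewrite -[X in _ + X <= _](divff (lt0r_neq0 r0)) -mulrDl.
by rewrite ler_pM2r ?invr_gt0//; lra.
Qed.

Lemma unit_interval_cell (K : nat) (x : R) : (0 < K)%N -> 0 <= x <= 1 ->
  exists a : 'I_K, a%:R / K%:R <= x <= (a.+1)%:R / K%:R.
Proof.
move=> K0 /andP[x0 x1].
have KR : 0 < K%:R :> R by rewrite ltr0n.
have xK0 : 0 <= x * K%:R by rewrite mulr_ge0.
have /andP[lo hi] := truncn_itv xK0.
have [lt|ge] := ltnP (Num.truncn (x * K%:R)) K.
  by exists (Ordinal lt); rewrite ler_pdivrMr// ler_pdivlMr// lo ltW.
(* Only [x = 1] reaches this case; it belongs to the last cell, as cells are closed. *)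
have K1 : (K.-1 < K)%N by rewrite prednK.
exists (Ordinal K1); rewrite /= prednK// ler_pdivrMr// divff ?lt0r_neq0// x1 andbT.
by apply: le_trans lo; rewrite ler_nat (leq_trans (leq_pred _) ge).
Qed.

End cells.

Section distance.
Context {R : realType}.
Implicit Types x y : R * R.

Lemma euclidean_dist_lt_coord x y (r : R) : euclidean_dist x y < r ->
  `|x.1 - y.1| < r /\ `|x.2 - y.2| < r.
Proof.
move=> h; split; apply: le_lt_trans h; rewrite -sqrtr_sqr ler_wsqrtr//.
  by rewrite lerDl sqr_ge0.
by rewrite lerDr sqr_ge0.
Qed.

Lemma coord_euclidean_dist_lt x y (r u v : R) : 0 < r ->
    `|x.1 - y.1| <= u -> `|x.2 - y.2| <= v -> u ^+ 2 + v ^+ 2 < r ^+ 2 ->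
  euclidean_dist x y < r.
Proof.
move=> r0 xu yv uv; rewrite -[ltRHS](gtr0_norm r0) -sqrtr_sqr ltr_sqrt ?exprn_gt0//.
apply: le_lt_trans uv; apply: lerD; rewrite -real_normK ?num_real//.
  by rewrite lerXn2r ?nnegrE// (le_trans _ xu).
by rewrite lerXn2r ?nnegrE// (le_trans _ yv).
Qed.

Definition cell (K : nat) (ab : 'I_K * 'I_K) : set (R * R) :=
  rectangle (ab.1%:R / K%:R) (ab.1.+1%:R / K%:R)
            (ab.2%:R / K%:R) (ab.2.+1%:R / K%:R).

Definition near_cell (r : R) (K : nat) (ab : 'I_K * 'I_K) : set (R * R) :=
  rectangle (ab.1%:R / K%:R - r) (ab.1.+1%:R / K%:R + r)
            (ab.2%:R / K%:R - r) (ab.2.+1%:R / K%:R + r).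

Lemma unit_square_cell (K : nat) x : (0 < K)%N -> unit_square x ->
  exists ab : 'I_K * 'I_K, cell ab x.
Proof.
move=> K0 [/= x1 x2]; move: x1 x2; rewrite !in_itv/= => x1 x2.
have [a ha] := unit_interval_cell K0 x1.
have [b hb] := unit_interval_cell K0 x2.
by exists (a, b); split; rewrite /= in_itv.
Qed.

Lemma dist_near_cell (r : R) (K : nat) (ab : 'I_K * 'I_K) x y : cell ab x ->
  euclidean_dist x y < r -> near_cell r ab y.
Proof.
move=> [/= x1 x2] /euclidean_dist_lt_coord; rewrite !ltr_norml => -[h1 h2].
move: x1 x2; rewrite !in_itv/= => /andP[l1 u1] /andP[l2 u2].
move/andP: h1 => [h1 h1']; move/andP: h2 => [h2 h2'].
by split; rewrite /= in_itv/=; apply/andP; split; lra.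
Qed.

Lemma cell_width (K a : nat) : (a.+1)%:R / K%:R - a%:R / K%:R = K%:R^-1 :> R.
Proof. by rewrite -mulrBl -natr1 addrAC subrr add0r mul1r. Qed.

Lemma cell_endpoints_le (K a : nat) : a%:R / K%:R <= (a.+1)%:R / K%:R :> R.
Proof. by rewrite ler_wpM2r ?invr_ge0// ler_nat. Qed.

Lemma prode_le_const {I : finType} (J : {set I}) (F : I -> \bar R) (c : R) :
  (forall i, i \in J -> 0 <= F i <= c%:E)%E -> (\prod_(i in J) F i <= (c ^+ #|J|)%:E)%E.
Proof.
move=> hF; rewrite -prodr_const.
suff : (0 <= \prod_(i in J) F i <= (\prod_(i in J) c)%:E)%E by case/andP.
elim/big_rec2: _ => [|i y x iJ /andP[x0 xy]]; first by rewrite lee_fin ler01 lexx.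
have /andP[F0 Fc] := hF _ iJ.
by rewrite mule_ge0// EFinM lee_pmul.
Qed.

Lemma probability_setI1 {d} {T : measurableType d} (P : probability T R) (A B : set T) :
  measurable A -> measurable B -> P B = 1%E -> (P A <= P (A `&` B))%E.
Proof.
move=> mA mB PB; have AE : (A `&` B) `|` (A `\` B) = A.
  apply/seteqP; split=> t; first by case=> -[].
  by move=> At; have [Bt|Bt] := pselect (B t); [left|right].
rewrite -{1}AE.
apply: (le_trans (measureU2 _ _ _)); [exact: measurableI|exact: measurableD|].
rewrite [X in (_ + X)%E](_ : _ = 0%E) ?adde0//.
apply/eqP; rewrite eq_le measure_ge0 andbT.
have : (P (~` B) = 0)%E by rewrite probability_setC// PB subee.
move=> <-; apply: le_measure; rewrite ?inE//.
- exact: measurableD.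
- exact: measurableC.
Qed.

End distance.

Section neighbours.
Context {R : realType} {eps1 eps2 : R} {f : R * R -> R} {Fc : R -> R} {d}
  {Omega : measurableType d} {P : probability Omega R} {n : nat} {p : R}
  {Z : edge n -> {RV P >-> bool}} {W : edge n -> {RV P >-> R}}
  {X : 'I_n -> {RV P >-> (R * R)%type}}.
Hypothesis heps1 : 0 < eps1.
Hypothesis heps12 : eps1 <= eps2.
Hypothesis hf : density_on_square f.
Hypothesis hfeps : forall x, unit_square x -> eps1 <= f x <= eps2.
Hypothesis model : bernoulli_rgg_model f Fc p Z W X.
Variable r : R.
Hypothesis r01 : 0 < r < 1.

Let eps20 : 0 <= eps2. Proof. exact: le_trans (ltW heps1) heps12. Qed.

Let close (i j : 'I_n) := [set t | euclidean_dist (X i t) (X j t) < r].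

(* The location of [i] is discretized: given that it lies in a cell of side
   comparable to [r], the other vertices lie in a square of side [3 r], and
   these events are independent. *)
Lemma close_probability i (J : {set 'I_n}) : i \notin J ->
  (P (\bigcap_(j in [set` J]) close i j) <= (eps2 * (9 * eps2 * r ^+ 2) ^+ #|J|)%:E)%E.
Proof.
move=> iJ; have [K [K0 /andP[K3 _]]] := cell_count r01.
have r0 : 0 < r by case/andP: r01.
have KR : 0 < K%:R :> R by rewrite ltr0n.
have Kr : K%:R^-1 <= r.
  rewrite invf_ple// (le_trans _ K3)// -[leLHS]mul1r ler_wpM2r ?invr_ge0 ?ltW//; lra.
have mclose : measurable (\bigcap_(j in [set` J]) close i j).
  apply: fin_bigcap_measurable => // j _.
  by apply: measurable_euclidean_dist_lt; exact: measurable_funP.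
have msq : measurable (X i @^-1` @unit_square R).
  rewrite -[X in measurable X]setTI; apply: measurable_funP => //.
  exact: measurable_unit_square.
apply: le_trans (probability_setI1 mclose msq (location_in_square hf model i)) _.
pose A (ab : 'I_K * 'I_K) k := if k == i then cell ab else near_cell r ab : set (R * R).
have mA ab k : measurable (A ab k).
  by rewrite /A; case: ifP => _; exact: measurable_rectangle.
pose B (ab : 'I_K * 'I_K) := \bigcap_(k in [set` (i |: J)%SET]) (X k @^-1` A ab k).
have mB ab : measurable (B ab).
  apply: fin_bigcap_measurable => // k _.
  by rewrite -[X in measurable X]setTI; exact: measurable_funP.
apply: (le_trans (measure_le_sum P (measurableI _ _ mclose msq) mB _)).
  move=> t [/= hJ /(unit_square_cell K0)[ab hab]].
  exists ab => // k /=; rewrite in_setU1 /A; case: eqVneq => [->//|ki] /= kJ.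
  exact: dist_near_cell hab (hJ _ kJ).
have PB ab : (P (B ab) <= ((eps2 * K%:R ^- 2) * (9 * eps2 * r ^+ 2) ^+ #|J|)%:E)%E.
  rewrite (mutually_independentP (location_indep model) _ (mA ab)) big_setU1//=.
  rewrite EFinM lee_pmul//; first by apply: prode_ge0.
    rewrite /A eqxx; apply: le_trans (location_rectangle_le heps1 hf hfeps model _ _ _ _) _ => //.
    - exact: cell_endpoints_le.
    - exact: cell_endpoints_le.
    by rewrite !cell_width -expr2 exprVn.
  apply: prode_le_const => j jJ; rewrite measure_ge0/= /A.
  case: eqVneq => [ji|_]; first by rewrite -ji jJ in iJ.
  have le3 (a : nat) : a%:R / K%:R - r <= (a.+1)%:R / K%:R + r.
    apply: (@le_trans _ _ (a%:R / K%:R)); first by rewrite gerBl ltW.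
    by apply: le_trans (cell_endpoints_le K a) _; rewrite lerDl ltW.
  apply: le_trans (location_rectangle_le heps1 hf hfeps model _ _ _ _) _ => //.
  have w (a : nat) : (a.+1)%:R / K%:R + r - (a%:R / K%:R - r) = K%:R^-1 + 2 * r.
    by rewrite -(cell_width K a); ring.
  rewrite !w lee_fin.
  have -> : 9 * eps2 * r ^+ 2 = eps2 * ((3 * r) * (3 * r)) by ring.
  rewrite ler_wpM2l//.
  have h0 : 0 <= K%:R^-1 + 2 * r by rewrite addr_ge0 ?invr_ge0// mulr_ge0// ltW.
  by apply: ler_pM => //; lra.
(* There are [K ^ 2] cells, each hit by vertex [i] with probability at most [eps2 / K ^ 2]: this
   produces the leading factor [eps2]. *)
apply: (le_trans (lee_sum _ (fun ab _ => PB ab))).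
rewrite sumEFin lee_fin sumr_const.
have -> : #|{: 'I_K * 'I_K}| = (K * K)%N by rewrite card_prod card_ord.
rewrite -[leLHS]mulr_natl natrM le_eqVlt; apply/orP; left; apply/eqP; field.
exact: lt0r_neq0.
Qed.

End neighbours.

(** * Moments of the incident and of the total weight *)

Section edges.
Context {n : nat}.
Implicit Types (e : edge n) (i : 'I_n).

(** The default [i] is never reached, as an edge has two elements. *)
Definition other i e : 'I_n := odflt i [pick u in val e :\ i]%SET.

Lemma otherP i e : i \in val e ->
  val e = [set i; other i e]%SET /\ other i e != i.
Proof.
move=> ie; have c1 : #|(val e :\ i)%SET| = 1%N.
  have := cardsD1 i (val e); rewrite ie (eqP (valP e)) add1n.
  by move=> [].
rewrite /other; case: pickP => [u|] /=; last first.
  by move=> h; move: c1; rewrite eq_card0.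
move=> uE; move: (uE); rewrite !inE => /andP[ui ue]; split=> //.
rewrite -(finset.setD1K ie); congr (_ |: _)%SET.
by move/eqP/cards1P: c1 uE => [v ->]; rewrite inE => /eqP ->.
Qed.

Lemma other_inj i e e' : i \in val e -> i \in val e' ->
  other i e = other i e' -> e = e'.
Proof.
move=> /otherP[h _] /otherP[h' _] E.
by apply: val_inj; rewrite h h' E.
Qed.

Lemma card_incident i : (#|[pred e : edge n | i \in val e]| <= n)%N.
Proof.
have := @leq_card_in _ _ (other i) [pred e : edge n | i \in val e].
by rewrite card_ord; apply => e e'; rewrite !inE; exact: other_inj.
Qed.

Lemma card_edge_le : (#|{: edge n}| <= n ^ 2)%N.
Proof.
have -> : #|{: edge n}| = #|[set A : {set 'I_n} | #|A| == 2%N]%SET|.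
  by rewrite card_sig cardsE.
rewrite card_draws card_ord bin2 -divn2 (leq_trans (leq_div _ _))//.
by rewrite -mulnn leq_mul// leq_pred.
Qed.

Lemma in_rgg {R : realType} (r : R) z x e u v : e \in rgg r z x ->
  u \in val e -> v \in val e -> u != v -> z e /\ euclidean_dist (x u) (x v) < r.
Proof.
rewrite inE => /andP[ze /forall_inP h] ue ve uv; split=> //.
by have /forall_inP/(_ v ve) := h u ue; rewrite uv.
Qed.

End edges.

(** From [a i * a j <= (a i ^+ 2 + a j ^+ 2) / 2] and symmetry. In this lopsided form each pair of
    edges costs the second moment of a single weight on a graph event. *)
Lemma sqr_sum_le {R : realType} {I : finType} (Q : pred I) (a : I -> R) :
  (\sum_(i | Q i) a i) ^+ 2 <= \sum_(i | Q i) \sum_(j | Q j) a i ^+ 2.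
Proof.
rewrite expr2 mulr_suml.
under eq_bigr => i _ do rewrite mulr_sumr.
have E : \sum_(i | Q i) \sum_(j | Q j) a i ^+ 2 =
    \sum_(i | Q i) \sum_(j | Q j) (a i ^+ 2 + a j ^+ 2) / 2.
  under [RHS]eq_bigr => i _ do under eq_bigr => j _ do rewrite mulrDl.
  under [RHS]eq_bigr => i _ do rewrite big_split.
  rewrite big_split/= [X in _ = _ + X]exchange_big/= -big_split/=.
  apply: eq_bigr => i _; rewrite -big_split/=; apply: eq_bigr => j _.
  by rewrite -mulrDl -mulr2n -[_ *+ 2]mulr_natr mulfK.
rewrite E; apply: ler_sum => i _; apply: ler_sum => j _.
rewrite -subr_ge0; have -> : (a i ^+ 2 + a j ^+ 2) / 2 - a i * a j = (a i - a j) ^+ 2 / 2.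
  by field.
by rewrite divr_ge0 ?sqr_ge0.
Qed.

Section incident_weight_moment.
Context {R : realType} {eps1 eps2 : R} {f : R * R -> R} {Fc : R -> R} {d}
  {Omega : measurableType d} {P : probability Omega R} {n : nat} {p : R}
  {Z : edge n -> {RV P >-> bool}} {W : edge n -> {RV P >-> R}}
  {X : 'I_n -> {RV P >-> (R * R)%type}}.
Hypothesis heps1 : 0 < eps1.
Hypothesis heps12 : eps1 <= eps2.
Hypothesis hf : density_on_square f.
Hypothesis hfeps : forall x, unit_square x -> eps1 <= f x <= eps2.
Hypothesis model : bernoulli_rgg_model f Fc p Z W X.
Hypothesis p0 : 0 <= p.
Variable r : R.
Hypothesis r01 : 0 < r < 1.

Let G := graph (Z := Z) (X := X) r.

(** Distinct edges at [i] have distinct other endpoints, so the bound is a power of [p] from the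
    states times [close_probability] for the locations. *)
Lemma edges_probability i (E : {set edge n}) :
    (forall e, e \in E -> i \in val e) ->
  (P [set t | E \subset G t] <= (eps2 * (9 * eps2 * p * r ^+ 2) ^+ #|E|)%:E)%E.
Proof.
move=> iE; pose J := [set other i e | e in E]%SET.
have iJ : i \notin J.
  by apply/imsetP => -[e eE ie]; have [_] := otherP (iE _ eE); rewrite -ie eqxx.
have cJ : #|J| = #|E|.
  by rewrite card_in_imset// => e e' eE e'E; apply: other_inj; exact: iE.
pose A := \bigcap_(e in [set` E]) (Z e @^-1` [set true]).
pose C := \bigcap_(j in [set` J]) [set t | euclidean_dist (X i t) (X j t) < r].
have ZA : family_sigma Z A by exact: family_sigma_bigcap.
have XC : family_sigma X C.
  apply: (@fin_bigcap_measurable _ (generated X)) => // j _.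
  by apply: (@measurable_euclidean_dist_lt _ _ (generated X));
    exact: measurable_generated.
have sub : [set t | E \subset G t] `<=` A `&` C.
  move=> t /= /fintype.subsetP EG; split=> [e /= eE|j /= /imsetP[e eE ->]].
    have [ve oi] := otherP (iE _ eE).
    by have [] := in_rgg (EG _ eE) (iE _ eE) (v := other i e);
      rewrite ?ve ?inE ?eqxx ?orbT// eq_sym.
  have [ve oi] := otherP (iE _ eE).
  by have [] := in_rgg (EG _ eE) (iE _ eE) (v := other i e);
    rewrite ?ve ?inE ?eqxx ?orbT// eq_sym.
apply: (@le_trans _ _ (P (A `&` C))).
  apply: le_measure; rewrite ?inE//.
    exact: (measurable_graph r (fun G0 => E \subset G0)).
  by apply: measurableI; [exact: family_sigma_measurable ZA|exact: family_sigma_measurable XC].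
rewrite (indep_states_locations model ZA XC).
rewrite (_ : eps2 * _ = p ^+ #|E| * (eps2 * (9 * eps2 * r ^+ 2) ^+ #|E|)); last first.
  by rewrite [RHS]mulrCA -exprMn; congr (_ * _ ^+ _); ring.
rewrite EFinM lee_pmul//.
  rewrite (mutually_independentP (state_indep model))//.
  by apply: prode_le_const => e _; rewrite measure_ge0/= (state_law model).
by rewrite -cJ; exact: (close_probability heps1 heps12 hf hfeps model r01).
Qed.

(** A bound on the second moment of a weight conditional on any event determined by the graph. *)
Variable B : R.
Hypothesis B0 : 0 <= B.
Hypothesis moment_le : forall (phi : pred {set edge n}) e,
  (\int[P]_(t in [set t | phi (G t)]) ((W e t) ^+ 2)%:E
    <= P [set t | phi (G t)] * B%:E)%E.

Let mW2 e (D : set Omega) : measurable D -> measurable_fun D (fun t => ((W e t) ^+ 2)%:E).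
Proof.
move=> mD; apply/measurable_EFinP; apply: measurable_funX; exact: measurable_funTS.
Qed.

Let mG (phi : pred {set edge n}) : measurable [set t | phi (G t)] := measurable_graph r phi.

Lemma measurable_graph_event (phi : pred {set edge n}) :
  measurable_fun setT (fun t => (phi (G t))%:R : R).
Proof.
rewrite (_ : (fun t => _) = \1_([set t | phi (G t)])); first exact: measurable_indic.
by apply/funext => t; rewrite indicE; congr ((nat_of_bool _)%:R); apply/idP/idP; rewrite inE.
Qed.

Lemma integral_graph_event (phi : pred {set edge n}) (g : Omega -> R) :
  (\int[P]_t ((phi (G t))%:R * g t)%:E = \int[P]_(t in [set t | phi (G t)]) (g t)%:E)%E.
Proof.
rewrite [RHS]integral_mkcond; apply: eq_integral => t _; rewrite /patch/=.
have [h|h] := boolP (phi (G t)); first by rewrite mem_set//= mul1r.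
by rewrite memNset/= ?mul0r//; exact/negP.
Qed.

Lemma measurable_incident_weight i :
  measurable_fun setT (fun t => incident_weight (G t) (fun e => W e t) i).
Proof.
rewrite (_ : (fun t => _) = fun t =>
    \sum_(e <- enum [pred e : edge n | i \in val e]) (e \in G t)%:R * W e t).
  apply: measurable_sum => e; apply: measurable_funM => //.
  exact: (measurable_graph_event (fun G0 => e \in G0)).
apply/funext => t; rewrite /incident_weight big_enum big_mkcondl/=.
by apply: eq_bigr => e _; case: (e \in G t); rewrite ?mul1r ?mul0r.
Qed.

(** With [q = 9 * eps2 * p * r ^+ 2], the at most [n] diagonal pairs of edges at [i] are present
    with probability at most [eps2 * q], the at most [n ^ 2] other pairs with probability at most
    [eps2 * q ^+ 2]. *)
Lemma incident_weight_moment i :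
  (\int[P]_t ((incident_weight (G t) (fun e => W e t) i) ^+ 2)%:E <=
   (B * (eps2 * (n%:R * (9 * eps2 * p * r ^+ 2) + (n%:R * (9 * eps2 * p * r ^+ 2)) ^+ 2)))%:E)%E.
Proof.
pose q := 9 * eps2 * p * r ^+ 2.
have e20 : 0 <= eps2 by rewrite (le_trans (ltW heps1)).
have q0 : 0 <= q by rewrite mulr_ge0 ?sqr_ge0// mulr_ge0// mulr_ge0.
pose S := enum [pred e : edge n | i \in val e].
have SR (F : edge n -> R) : \sum_(e <- S) F e = \sum_(e : edge n | i \in val e) F e.
  by rewrite /S big_enum.
have SE (F : edge n -> \bar R) : (\sum_(e <- S) F e = \sum_(e : edge n | i \in val e) F e)%E.
  by rewrite /S big_enum.
pose phi (e e' : edge n) : pred {set edge n} := fun G0 => [set e; e']%SET \subset G0.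
pose g (e e' : edge n) t : R := (phi e e' (G t))%:R * W e t ^+ 2.
have g0 e e' t : 0 <= g e e' t by rewrite mulr_ge0 ?sqr_ge0.
have mg e e' : measurable_fun setT (fun t => (g e e' t)%:E).
  apply/measurable_EFinP; apply: measurable_funM; last exact: measurable_funX.
  exact: measurable_graph_event.
have ig (e e' : edge n) : i \in val e -> i \in val e' ->
    (\int[P]_t (g e e' t)%:E <= (eps2 * q ^+ #|[set e; e']%SET| * B)%:E)%E.
  move=> ie ie'; rewrite integral_graph_event; apply: (le_trans (moment_le _ _)).
  rewrite EFinM lee_wpmul2r// ?lee_fin//.
  by apply: (@edges_probability i) => e''; rewrite !inE => /orP[] /eqP ->.
apply: (@le_trans _ _ (\int[P]_t \sum_(e <- S) \sum_(e' <- S) (g e e' t)%:E)%E).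
  apply: ge0_le_integral => //.
  - by move=> t _; rewrite lee_fin sqr_ge0.
  - apply/measurable_EFinP; apply: measurable_funX.
    exact: measurable_incident_weight.
  - by apply: emeasurable_sum => e; apply: emeasurable_sum => e'.
  move=> t _; under eq_bigr do rewrite sumEFin SR.
  rewrite sumEFin SR lee_fin; apply: (le_trans (sqr_sum_le _ _)).
  rewrite big_mkcondl/=; apply: ler_sum => e _; rewrite /g /phi.
  case: (boolP (e \in G t)) => eG; last by apply: sumr_ge0 => e' _; exact: (g0 e e' t).
  rewrite big_mkcondl/=; apply: ler_sum => e' _; rewrite finset.subUset !finset.sub1set eG.
  by case: (e' \in G t); rewrite ?mul1r ?mul0r.
rewrite ge0_integral_sum//; [|by move=> e; apply: emeasurable_sum => e'|by move=> e t _; apply: sume_ge0 => e' _; rewrite lee_fin].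
rewrite SE.
apply: (@le_trans _ _ (\sum_(e : edge n | i \in val e) (B * (eps2 * (q + n%:R * q ^+ 2)))%:E)%E).
  apply: lee_sum => e ie; rewrite ge0_integral_sum//; last by move=> e' t _; rewrite lee_fin.
  rewrite SE; apply: (le_trans (lee_sum _ (fun e' ie' => ig e e' ie ie'))).
  rewrite sumEFin lee_fin -mulr_suml -mulr_sumr mulrC ler_wpM2l//.
  rewrite ler_wpM2l// (bigD1 e)//= finset.setUid cards1 expr1 lerD2l.
  apply: (@le_trans _ _ (\sum_(e' : edge n | i \in val e') q ^+ 2)); last first.
    by rewrite sumr_const -[leLHS]mulr_natl ler_wpM2r ?sqr_ge0// ler_nat card_incident.
  rewrite [leRHS](bigD1 e)//= -[leLHS]add0r lerD ?sqr_ge0//.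
  by apply: ler_sum => e' /andP[_ e'e]; rewrite cards2 eq_sym e'e.
rewrite sumEFin lee_fin sumr_const -[leLHS]mulr_natl.
rewrite [leRHS](_ : _ = n%:R * (B * (eps2 * (q + n%:R * q ^+ 2)))); last by rewrite /q; ring.
rewrite ler_wpM2r ?ler_nat ?card_incident//.
by rewrite mulr_ge0// mulr_ge0// addr_ge0// mulr_ge0// sqr_ge0.
Qed.

Lemma total_weight_moment (phi : pred {set edge n}) :
  (\int[P]_(t in [set t | phi (G t)]) ((\sum_e W e t) ^+ 2)%:E <=
   P [set t | phi (G t)] * (n%:R ^+ 4 * B)%:E)%E.
Proof.
have mphiG := mG phi.
apply: (@le_trans _ _ (\int[P]_(t in [set t | phi (G t)])
    \sum_(e : edge n) \sum_(e' : edge n) ((W e t) ^+ 2)%:E)%E).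
  apply: ge0_le_integral => //.
  - by move=> t _; rewrite lee_fin sqr_ge0.
  - apply/measurable_EFinP; apply: measurable_funX; apply: measurable_sum => e.
    exact: measurable_funTS.
  - by do 2 apply: emeasurable_sum => ?; exact: mW2.
  move=> t _; under [leRHS]eq_bigr do rewrite sumEFin.
  by rewrite sumEFin lee_fin; exact: (sqr_sum_le xpredT).
rewrite ge0_integral_sum//; last 2 first.
- by move=> e; apply: emeasurable_sum => e'; exact: mW2.
- by move=> e t _; apply: sume_ge0 => e' _; rewrite lee_fin sqr_ge0.
under eq_bigr => e _.
  rewrite ge0_integral_sum//; [|by move=> e'; exact: mW2|by move=> e' t _; rewrite lee_fin sqr_ge0].
  over.
have PE : P [set t | phi (G t)] \is a fin_num by exact: fin_num_measure.
apply: (@le_trans _ _ (\sum_(e : edge n) \sum_(e' : edge n) (fine (P [set t | phi (G t)]) * B)%:E)%E).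
  apply: lee_sum => e _; apply: lee_sum => e' _.
  by rewrite EFinM fineK//; exact: moment_le.
rewrite -[X in (_ <= X * _)%E](fineK PE) -EFinM.
under eq_bigr do rewrite sumEFin; rewrite sumEFin lee_fin.
rewrite !sumr_const -mulrnA -[leLHS]mulr_natl mulrCA ler_wpM2l ?fine_ge0//.
rewrite ler_wpM2r//.
rewrite -natrX ler_nat (leq_trans (leq_mul card_edge_le card_edge_le))//.
by rewrite -expnD.
Qed.

End incident_weight_moment.

(** * Connectivity *)

Section grid_connectivity.
Context {n : nat} (G : {set edge n}) (i : 'I_n).

Let linked u v := connect (adj (inner G [set~ i]%SET)) u v.

Lemma connected_of_cuts (A : {set 'I_n}) : i \notin A ->
    (forall S : {set 'I_n}, S \subset A -> S != finset.set0 ->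
      (#|S| <= #|A :\: S|)%N ->
      exists u v, [/\ u \in S, v \in (A :\: S)%SET & adj G u v]) ->
  forall u v, u \in A -> v \in A -> linked u v.
Proof.
move=> iA cut u v uA vA; apply: contrapT => /negP nuv.
pose S := [set w in A | linked u w]%SET.
have SA : S \subset A by apply/fintype.subsetP => w; rewrite inE => /andP[].
have inner_adj a b : a \in A -> b \in A -> adj G a b -> linked a b.
  move=> aA bA /existsP[e /andP[eG /eqP eab]]; apply/connect1/existsP.
  exists e; rewrite inE eG eab eqxx andbT/=; apply/fintype.subsetP => w.
  by rewrite !inE => /orP[] /eqP ->; apply: contraNneq iA => <-.
have noedge a b : a \in S -> b \in (A :\: S)%SET -> adj G a b -> False.
  rewrite !inE => /andP[aA ua] /andP[]; rewrite negb_and => + bA ab; rewrite bA/=.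
  by move/negP; apply; apply: connect_trans ua (inner_adj _ _ aA bA ab).
have DS : (A :\: (A :\: S))%SET = S by rewrite finset.setDDr finset.setDv finset.set0U; apply/finset.setIidPr.
have [le|lt] := leqP #|S| #|(A :\: S)%SET|.
  have [|a [b [aS bS ab]]] := cut S SA _ le; last exact: noedge ab.
  by apply/set0Pn; exists u; rewrite inE uA; exact: connect0.
(* Here the part reached from [u] is the larger side, so the criterion is applied to its
   complement. *)
have [||a [b [aS bS ab]]] := cut (A :\: S)%SET (finset.subsetDl _ _).
- by apply/set0Pn; exists v; rewrite !inE vA (negbTE nuv).
- by rewrite DS ltnW.
by apply: (noedge b a) => //; [rewrite -DS|rewrite adj_sym].
Qed.

(** [V] stands for the occupants of cells and [U] for those of 2 x 2 windows. Adjacent cells share a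
    window, and every cell has a vertex other than [i] to step on, so all cells are reached from the
    corner: first in the second index, then in the first. *)
Lemma grid_connected (K : nat) (V U : nat -> nat -> {set 'I_n}) : (0 < K)%N ->
    (forall v, exists a b, [/\ (a < K)%N, (b < K)%N & v \in V a b]) ->
    (forall a b, (a < K)%N -> (b < K)%N -> exists2 v, v \in V a b & v != i) ->
    (forall a b v, v \in V a b -> v \in U a b) ->
    (forall a b v, v \in V a.+1 b -> v \in U a b) ->
    (forall a b v, v \in V a b.+1 -> v \in U a b) ->
    (forall a b u v, (a < K)%N -> (b < K)%N -> u \in U a b -> v \in U a b ->
      u != i -> v != i -> linked u v) ->
  inner_connected G [set~ i]%SET.
Proof.
move=> K0 cover ne VU VUa VUb Ul.
have [v0 v0V v0i] := ne _ _ K0 K0.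
have H0 b : (b < K)%N -> forall v, v \in V 0%N b -> v != i -> linked v0 v.
  elim: b => [_|b IH bK] v vV vi; first by exact: (Ul _ _ _ _ K0 K0 (VU _ _ _ v0V) (VU _ _ _ vV) v0i vi).
  have [w wV wi] := ne 0%N b K0 (ltnW bK).
  apply: connect_trans (IH (ltnW bK) _ wV wi) _.
  exact: (Ul _ _ _ _ K0 (ltnW bK) (VU _ _ _ wV) (VUb _ _ _ vV) wi vi).
have H a : (a < K)%N -> forall b, (b < K)%N -> forall v, v \in V a b -> v != i -> linked v0 v.
  elim: a => [_|a IH aK] b bK v vV vi; first exact: H0 bK _ vV vi.
  have [w wV wi] := ne a b (ltnW aK) bK.
  apply: connect_trans (IH (ltnW aK) _ bK _ wV wi) _.
  exact: (Ul _ _ _ _ (ltnW aK) bK (VU _ _ _ wV) (VUa _ _ _ vV) wi vi).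
have all_linked v : v != i -> linked v0 v.
  by move=> vi; have [a [b [aK bK vV]]] := cover v; exact: (H a aK b bK).
apply/inner_connectedP => u v; rewrite !inE => ui vi.
apply: connect_trans (all_linked _ vi); rewrite connect_adj_sym; exact: all_linked.
Qed.

End grid_connectivity.

(** * Crossing edges, occupancy and cuts in a window *)

Section cuts.
Context {n : nat}.
Implicit Types S T : {set 'I_n}.

Definition crossing S T : {set edge n} :=
  [set e : edge n | [exists u in S, exists v in T, val e == [set u; v]%SET]]%SET.

Lemma card_crossing S T : [disjoint S & T]%B -> #|crossing S T| = (#|S| * #|T|)%N.
Proof.
move=> dST; rewrite -cardsX -(card_imset (crossing S T) val_inj).
pose g (uv : 'I_n * 'I_n) := [set uv.1; uv.2]%SET.
have -> : [set val e | e in crossing S T]%SET = (g @: (finset.setX S T))%SET.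
  apply/setP => A; apply/imsetP/imsetP => [[e]|[[u v]]].
    rewrite inE => /existsP[u /andP[uS /existsP[v /andP[vT /eqP eE]]]] ->.
    by exists (u, v); rewrite // inE uS.
  rewrite inE/= => /andP[uS vT] ->.
  have uv : u != v.
    by apply: contraTneq uS => ->; rewrite (disjointFl dST).
  have c2 : #|[set u; v]%SET| == 2%N by rewrite cards2 uv.
  exists (exist _ [set u; v]%SET c2 : edge n) => //.
  rewrite inE; apply/existsP; exists u; rewrite uS/=; apply/existsP; exists v.
  by rewrite vT/=.
rewrite card_in_imset// => -[u v] [u' v']; rewrite !inE/= => /andP[uS vT] /andP[u'S v'T].
move=> guv; have /set2_eqP[[-> ->]//|[uv' _]] : [set u; v]%SET = [set u'; v']%SET := guv.
by rewrite uv' (disjointFl dST) in uS.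
Qed.

End cuts.

Lemma sum_nonempty_subsets {R : comRingType} (n : nat) (x : R) :
  \sum_(S : {set 'I_n} | S != finset.set0) x ^+ #|S| = (1 + x) ^+ n - 1.
Proof.
have -> : (1 + x) ^+ n = \sum_(S : {set 'I_n}) x ^+ #|S|.
  transitivity (\prod_(j < n) (x + 1)); first by rewrite prodr_const card_ord addrC.
  rewrite bigA_distr; apply: eq_bigr => S _.
  by rewrite -prodr_const [RHS]big_mkcond.
by rewrite [in RHS](bigD1 finset.set0)//= cards0 addrAC subrr add0r.
Qed.

Section occupancy.
Context {R : realType} {f : R * R -> R} {Fc : R -> R} {d}
  {Omega : measurableType d} {P : probability Omega R} {n : nat} {p : R}
  {Z : edge n -> {RV P >-> bool}} {W : edge n -> {RV P >-> R}}
  {X : 'I_n -> {RV P >-> (R * R)%type}}.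
Hypothesis model : bernoulli_rgg_model f Fc p Z W X.
Hypothesis p01 : 0 <= p <= 1.

Definition occupants (B : set (R * R)) (t : Omega) : {set 'I_n} :=
  [set j | `[< B (X j t) >]]%SET.

Section one_set.
Variables (B : set (R * R)) (mB : measurable B).

Lemma occupants_bigcap (A : {set 'I_n}) : [set t | occupants B t = A] =
  \bigcap_(j in [set: 'I_n]) (X j @^-1` (if j \in A then B else ~` B)).
Proof.
apply/seteqP; split=> t /=.
  by move=> <- j _ /=; rewrite inE; case: asboolP.
move=> h; apply/setP => j; rewrite inE; have := h j Logic.I => /=.
by case: (j \in A) => ?; apply/asboolP.
Qed.

Let mBA (A : {set 'I_n}) j : measurable (if j \in A then B else ~` B).
Proof. by case: ifP => _ //; exact: measurableC. Qed.

Lemma family_sigma_occupants (A : {set 'I_n}) :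
  family_sigma X [set t | occupants B t = A].
Proof. by rewrite occupants_bigcap; exact: family_sigma_bigcap. Qed.

Lemma measurable_occupants (phi : pred {set 'I_n}) :
  measurable [set t | phi (occupants B t)].
Proof.
apply: measurable_fibers => A; exact: family_sigma_measurable (family_sigma_occupants A).
Qed.

Lemma measurable_occupants_eq (A : {set 'I_n}) :
  measurable [set t | occupants B t = A].
Proof. exact: family_sigma_measurable (family_sigma_occupants A). Qed.

Lemma occupants_probability (q : R) (A : {set 'I_n}) :
    (forall j, P (X j @^-1` B) = q%:E) ->
  P [set t | occupants B t = A] = (\prod_j (if j \in A then q else 1 - q))%:E.
Proof.
move=> Pq; rewrite occupants_bigcap (mutually_independent_setT (location_indep model))//.
rewrite -prodEFin; apply: eq_bigr => j _; case: (j \in A) => //.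
rewrite preimage_setC probability_setC ?Pq//.
by rewrite -[X in measurable X]setTI; exact: measurable_funP.
Qed.

(* Chernoff's lower-tail bound, from [E exp (- #|occupants|)]. *)
Lemma few_occupants_probability (q : R) (k : nat) : 0 <= q <= 1 ->
    (forall j, P (X j @^-1` B) = q%:E) ->
  (P [set t | (#|occupants B t| <= k)%N] <= (expR (k%:R - n%:R * q / 2))%:E)%E.
Proof.
move=> /andP[q0 q1] Pq.
have mk := measurable_occupants (fun A => #|A| <= k)%N.
rewrite (measure_fibers P mk measurable_occupants_eq).
(* Markov's inequality: a set [A] with at most [k] elements is charged the factor
   [exp (k - #|A|) >= 1], and larger sets contribute nothing on the left. *)
pose F (A : {set 'I_n}) := \prod_j (if j \in A then q * expR (-1) else 1 - q).
apply: (@le_trans _ _ (\sum_A (expR k%:R * F A)%:E)%E).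
  apply: lee_sum => A _; have [Ak|kA] := leqP #|A| k; last first.
    rewrite (_ : _ `&` _ = set0) ?measure0 ?lee_fin.
      rewrite mulr_ge0 ?expR_ge0//; apply: prodr_ge0 => j _.
      by case: ifP => _; rewrite ?subr_ge0// mulr_ge0 ?expR_ge0.
    apply/seteqP; split=> t //= [+ tA]; rewrite tA => Ak.
    by rewrite leqNgt kA in Ak.
  apply: (@le_trans _ _ (P [set t | occupants B t = A])).
    apply: le_measure; rewrite ?inE//; last exact: measurable_occupants_eq.
    by apply: measurableI => //; exact: measurable_occupants_eq.
  rewrite (occupants_probability A Pq) lee_fin.
  have -> : F A = expR (-1) ^+ #|A| * \prod_j (if j \in A then q else 1 - q).
    rewrite -prodr_const [in RHS]big_mkcond -big_split/=; apply: eq_bigr => j _.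
    by case: (j \in A); rewrite ?mul1r// mulrC.
  rewrite mulrA -[leLHS]mul1r ler_wpM2r//.
    by apply: prodr_ge0 => j _; case: ifP => _; rewrite ?subr_ge0.
  rewrite -expRM_natl -expRD -[leLHS]expR0 ler_expR mulrN mulr1 subr_ge0.
  by rewrite ler_nat.
rewrite sumEFin lee_fin -mulr_sumr -bigA_distr prodr_const card_ord expRD ler_wpM2l ?expR_ge0//.
have -> : - (n%:R * q / 2) = n%:R * - (q / 2) by rewrite mulrN mulrA.
rewrite expRM_natl lerXn2r ?nnegrE ?expR_ge0//.
  by rewrite addr_ge0 ?subr_ge0// mulr_ge0 ?expR_ge0.
apply: le_trans (expR_ge1Dx _).
(* Thus [1 - q + q * exp (-1) <= 1 - q / 2 <= exp (- q / 2)], the source of the 2 in the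
   exponent. *)
have : expR (-1) <= 2^-1 :> R.
  by rewrite expRN lef_pV2 ?posrE ?expR_gt0//; have := expR_ge1Dx (1 : R); lra.
by move=> /(ler_wpM2l q0) h; apply: le_trans (lerD h (lexx _)) _; lra.
Qed.

End one_set.

(** Stated on the states alone, hence independent of the locations; in a set of diameter less than
    [r], a missing edge has its state equal to 0. *)
Definition cut_event (S T : {set 'I_n}) : set Omega :=
  \bigcap_(e in [set` crossing S T]) (Z e @^-1` [set false]).

Lemma cut_probability (S T : {set 'I_n}) : [disjoint S & T]%B ->
  P (cut_event S T) = ((1 - p) ^+ (#|S| * #|T|))%:E.
Proof.
move=> dST; rewrite (mutually_independentP (state_indep model))//.
rewrite -(card_crossing dST) -prodr_const -prodEFin; apply: eq_bigr => e _.
have -> : Z e @^-1` [set false] = ~` (Z e @^-1` [set true]).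
  by apply/seteqP; split=> t /=; case: (Z e t).
rewrite probability_setC ?(state_law model)//.
by rewrite -[X in measurable X]setTI; exact: measurable_funP.
Qed.

Variables (r : R) (i : 'I_n) (m : nat).
Let G := graph (Z := Z) (X := X) r.

(** [AS.1] is the set of occupants of [B] and [AS.2] the smaller side of a cut of the occupants
    other than [i]. Fixing the occupants makes the cut deterministic. *)
Definition cut_piece (B : set (R * R)) (AS : {set 'I_n} * {set 'I_n}) : set Omega :=
  let A := (AS.1 :\ i)%SET in
  if [&& (2 * m < #|AS.1|)%N, AS.2 \subset A, AS.2 != finset.set0 &
      (#|AS.2| <= #|(A :\: AS.2)%SET|)%N]
  then [set t | occupants B t = AS.1] `&` cut_event AS.2 (A :\: AS.2)%SET
  else set0.

Lemma measurable_cut_piece (B : set (R * R)) AS : measurable B ->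
  measurable (cut_piece B AS).
Proof.
move=> mB; rewrite /cut_piece; case: ifP => // _; apply: measurableI.
  exact: measurable_occupants_eq.
apply: fin_bigcap_measurable => // e _.
by rewrite -[X in measurable X]setTI; exact: measurable_funP.
Qed.

Lemma window_connected (B : set (R * R)) t :
    (forall x y, B x -> B y -> euclidean_dist x y < r) ->
    (2 * m < #|occupants B t|)%N -> ~ (\bigcup_AS cut_piece B AS) t ->
  forall u v, u \in occupants B t -> v \in occupants B t -> u != i -> v != i ->
  connect (adj (inner (G t) [set~ i]%SET)) u v.
Proof.
move=> Br om ncut u v uo vo ui vi.
apply: (@connected_of_cuts _ _ _ (occupants B t :\ i)%SET);
  rewrite ?in_setD1 ?eqxx ?ui ?vi//.
move=> S SA S0 SD; apply: contrapT => nadj; apply: ncut.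
exists (occupants B t, S) => //; rewrite /cut_piece/= om SA S0 SD/=; split=> //.
move=> e /=; rewrite inE => /existsP[a /andP[aS /existsP[b /andP[bD /eqP eab]]]].
apply/negbTE/negP => Ze; apply: nadj; exists a, b; split=> //.
apply/existsP; exists e; rewrite eab eqxx andbT inE Ze /= eab.
have occB x : x \in [set a; b]%SET -> B (X x t).
  have Ao y : y \in (occupants B t :\ i)%SET -> B (X y t).
    by rewrite !inE => /andP[_ /asboolP].
  rewrite !inE => /orP[] /eqP ->; apply: Ao.
    exact: (fintype.subsetP SA).
  by move: bD; rewrite inE => /andP[].
apply/forall_inP => x /occB xB; apply/forall_inP => y /occB yB; apply/implyP => _.
exact: Br.
Qed.

(** Given the occupants, a cut with smaller side [S] is empty of edges with probability at most
    [x ^+ #|S|], [x = (1 - p) ^+ m]. Summing over all nonempty [S] gives [(1 + x) ^+ n - 1], and the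
    laws of the occupants sum to 1. *)
Lemma cut_pieces_probability (B : set (R * R)) (q : R) : measurable B ->
    0 <= q <= 1 ->
    (forall j, P (X j @^-1` B) = q%:E) ->
  (P (\bigcup_AS cut_piece B AS) <= ((1 + (1 - p) ^+ m) ^+ n - 1)%:E)%E.
Proof.
move=> mB q01 Pq.
have mpieces : measurable (\bigcup_AS cut_piece B AS).
  by apply: fin_bigcup_measurable => // AS _; exact: measurable_cut_piece.
apply: (le_trans (measure_le_sum P mpieces (fun AS => measurable_cut_piece AS mB) (fun t h => h))).
set x := (1 - p) ^+ m.
pose PA (A : {set 'I_n}) := \prod_j (if j \in A then q else 1 - q).
pose xS (S : {set 'I_n}) := if S != finset.set0 then x ^+ #|S| else 0.
have x0 : 0 <= x by rewrite exprn_ge0// subr_ge0; case/andP: p01.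
have PA0 A : 0 <= PA A.
  by apply: prodr_ge0 => j _; case: ifP => _; rewrite ?subr_ge0; case/andP: q01.
apply: (@le_trans _ _ (\sum_AS (PA AS.1 * xS AS.2)%:E)%E).
  apply: lee_sum => -[A S] _; rewrite /cut_piece/= /xS.
  case: ifP => [/and4P[mA SA S0 SD]|_]; last first.
    by rewrite measure0 lee_fin mulr_ge0//; case: ifP => // _; exact: exprn_ge0.
  have dS : [disjoint S & ((A :\ i) :\: S)%SET]%B.
    by rewrite -finset.setI_eq0 finset.setIDA finset.setIC -finset.setIDA finset.setDv finset.setI0.
  have ZC : family_sigma Z (cut_event S ((A :\ i) :\: S)%SET) by exact: family_sigma_bigcap.
  rewrite S0 setIC (indep_states_locations model ZC (family_sigma_occupants mB A)).
  rewrite (occupants_probability mB A Pq) cut_probability// -EFinM lee_fin mulrC.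
  rewrite ler_wpM2l ?PA0// mulnC exprM.
  (* At least [2 * m + 1] occupants leave at least [2 * m] without [i], so the larger side has at
     least [m]. *)
  have mD : (m <= #|((A :\ i) :\: S)%SET|)%N.
    have half (a b c u v : nat) : (u <= v -> 2 * m < a -> u + v = c -> a = b + c ->
      b <= 1 -> m <= v)%N by lia.
    have cS := cardsID S (A :\ i)%SET; rewrite (finset.setIidPr SA) in cS.
    exact: half SD mA cS (cardsD1 i A) (leq_b1 _).
  rewrite lerXn2r ?nnegrE ?exprn_ge0 ?subr_ge0//; [by case/andP: p01..|].
  rewrite /x ler_wiXn2l// ?subr_ge0 ?gerBl; by case/andP: p01.
rewrite sumEFin lee_fin.
have -> : \sum_(AS : {set 'I_n} * {set 'I_n}) PA AS.1 * xS AS.2 =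
    \sum_A \sum_S PA A * xS S by rewrite pair_big.
rewrite -(sum_nonempty_subsets n x).
under eq_bigr do rewrite -mulr_sumr.
have -> : \sum_A PA A * \sum_S xS S = \sum_S xS S.
  rewrite -mulr_suml (_ : \sum_A PA A = 1) ?mul1r//.
  transitivity (\prod_(j < n) (q + (1 - q))); first by rewrite bigA_distr.
  by rewrite big1// => j _; rewrite addrCA subrr addr0.
by rewrite [leRHS]big_mkcond.
Qed.

End occupancy.

Section disconnection.
Context {R : realType} {eps1 eps2 : R} {f : R * R -> R} {Fc : R -> R} {d}
  {Omega : measurableType d} {P : probability Omega R} {n : nat} {p : R}
  {Z : edge n -> {RV P >-> bool}} {W : edge n -> {RV P >-> R}}
  {X : 'I_n -> {RV P >-> (R * R)%type}}.
Hypothesis heps1 : 0 < eps1.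
Hypothesis hf : density_on_square f.
Hypothesis hfeps : forall x, unit_square x -> eps1 <= f x <= eps2.
Hypothesis model : bernoulli_rgg_model f Fc p Z W X.
Hypothesis p01 : 0 < p < 1.
Variable r : R.
Hypothesis r01 : 0 < r < 1.

Let G := graph (Z := Z) (X := X) r.

(** Indices are natural numbers, as in [grid_connected]; windows of the last row or column reach
    beyond the unit square. *)
Definition window (K a b : nat) : set (R * R) :=
  rectangle (a%:R / K%:R) (a.+2%:R / K%:R) (b%:R / K%:R) (b.+2%:R / K%:R).

Definition grid_cell (K a b : nat) : set (R * R) :=
  rectangle (a%:R / K%:R) (a.+1%:R / K%:R) (b%:R / K%:R) (b.+1%:R / K%:R).

Lemma window_diameter (K a b : nat) x y : (0 < K)%N -> 3 / r <= K%:R ->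
  window K a b x -> window K a b y -> euclidean_dist x y < r.
Proof.
move=> K0 K3 [/= x1 x2] [/= y1 y2].
have r0 : 0 < r by case/andP: r01.
have KR : 0 < K%:R :> R by rewrite ltr0n.
have Kr : 3 * K%:R^-1 <= r.
  by rewrite -ler_pdivlMr ?invr_gt0// invrK mulrC -ler_pdivrMr.
have w (c : nat) : c.+2%:R / K%:R = c%:R / K%:R + 2 * K%:R^-1 :> R.
  by rewrite -mulrDl -addn2 natrD.
move: x1 x2 y1 y2; rewrite !in_itv/= !(w a, w b) => /andP[? ?] /andP[? ?] /andP[? ?] /andP[? ?].
apply: (@coord_euclidean_dist_lt _ _ _ _ (2 * K%:R^-1) (2 * K%:R^-1)) => //.
- by rewrite ler_norml; apply/andP; split; lra.
- by rewrite ler_norml; apply/andP; split; lra.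
have K1 : 0 < K%:R^-1 :> R by rewrite invr_gt0.
nra.
Qed.

Lemma exprD1_le (y : R) (k : nat) : 0 <= y -> k%:R * y <= 2^-1 ->
  (1 + y) ^+ k <= 1 + 2 * k%:R * y.
Proof.
move=> y0; elim: k => [|k IH] ky; first by rewrite expr0 mulr0 mul0r addr0.
have ky' : k%:R * y <= 2^-1 by apply: le_trans ky; rewrite ler_wpM2r// ler_nat.
rewrite exprSr; apply: (le_trans (ler_wpM2r _ (IH ky'))); first by rewrite addr_ge0.
rewrite -natr1; have := ler_wpM2r y0 ky'; nra.
Qed.

(** Disconnection needs a vertex outside the square, a cell with at most [2 * m] vertices, or a
    window with an empty cut. The 48 is [16 * 3]: there are [K ^ 2 <= 16 * n] cells, each costing at
    most [y + 2 * n * y <= 3 * n * y]. *)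
Lemma disconnected_probability (i : 'I_n) :
    let D := n%:R * r ^+ 2 * p in let y := expR (- (eps1 * D / 256)) in
    1 <= D -> 256 <= eps1 * D -> n%:R * y <= 2^-1 ->
  (P [set t | ~~ inner_connected (G t) [set~ i]%SET] <= (48 * n%:R ^+ 2 * y)%:E)%E.
Proof.
move=> D y D1 eD ny.
have /andP[r0 r1] := r01; have /andP[p0 p1] := p01.
have [K [K0 /andP[K3 K4]]] := cell_count r01.
have KR : 0 < K%:R :> R by rewrite ltr0n.
pose q0 := eps1 / K%:R ^+ 2.
have nr : D <= n%:R * r ^+ 2.
  rewrite /D -[leRHS]mulr1; apply: ler_wpM2l; [by rewrite mulr_ge0// sqr_ge0|exact: ltW].
have K2 : K%:R ^+ 2 * r ^+ 2 <= 16.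
  rewrite -exprMn; have -> : 16 = 4 ^+ 2 :> R by ring.
  have Kr4 : K%:R * r <= 4 by rewrite -ler_pdivlMr.
  by rewrite lerXn2r ?nnegrE ?(mulr_ge0 (ltW KR) (ltW r0)).
have q0r : eps1 * r ^+ 2 / 16 <= q0.
  rewrite /q0 ler_pdivrMr// mulrAC ler_pdivlMr ?exprn_gt0// -mulrA.
  by rewrite (ler_wpM2l (ltW heps1))// mulrC.
have nq0 : eps1 * (n%:R * r ^+ 2) / 16 <= n%:R * q0.
  have -> : eps1 * (n%:R * r ^+ 2) / 16 = n%:R * (eps1 * r ^+ 2 / 16) by ring.
  exact: ler_wpM2l.
have q0_gt0 : 0 < q0 by rewrite divr_gt0 ?exprn_gt0.
(* A cell has on average at least [n * q0] vertices. As [2 * m <= n * q0 / 4], Chernoff's exponent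
   is at most [- n * q0 / 4]; as [m >= n * q0 / 16], [m * p >= eps1 * D / 256], the exponent in
   [y]. *)
pose m := Num.truncn (n%:R * q0 / 8).
have nq8 : 0 <= n%:R * q0 / 8 by rewrite divr_ge0// mulr_ge0// ltW.
have /andP[mlo mhi] := truncn_itv nq8; rewrite -/m in mlo mhi.
have eDnr : eps1 * D <= eps1 * (n%:R * r ^+ 2) by apply: (ler_wpM2l (ltW heps1)).
(* This keeps the unit lost by truncation below [n * q0 / 16]. *)
have a16 : 16 <= n%:R * q0.
  have := le_trans eD eDnr; move: nq0; set a := n%:R * q0; set b := eps1 * _.
  by move=> *; lra.
have m16 : n%:R * q0 / 16 <= m%:R.
  by move: mhi; rewrite -(natr1 m); move: a16; set a := n%:R * q0 => *; lra.
have m4 : 2 * m%:R <= n%:R * q0 / 4.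
  by move: mlo; set a := n%:R * q0 => *; lra.
have mD : eps1 * D / 256 <= m%:R * p.
  have -> : eps1 * D / 256 = eps1 * (n%:R * r ^+ 2) / 256 * p by rewrite /D; ring.
  apply: (ler_wpM2r (ltW p0)); apply: le_trans m16.
  by move: nq0; set a := n%:R * q0; set b := eps1 * _ => *; lra.
have xy : (1 - p) ^+ m <= y.
  have p1e : 1 - p <= expR (- p) by exact: expR_ge1Dx.
  apply: (@le_trans _ _ (expR (- p) ^+ m)).
    by rewrite lerXn2r ?nnegrE ?expR_ge0// subr_ge0 ltW.
  by rewrite -expRM_natl ler_expR mulrN lerN2.
have x0 : 0 <= (1 - p) ^+ m by rewrite exprn_ge0// subr_ge0 ltW.
have p01' : 0 <= p <= 1 by rewrite !ltW.
have prob_q (B : set (R * R)) : measurable B ->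
    0 <= fine (P (X i @^-1` B)) <= 1 /\
    forall j, P (X j @^-1` B) = (fine (P (X i @^-1` B)))%:E.
  move=> mB; have mXB : measurable (X i @^-1` B).
    by rewrite -[X in measurable X]setTI; exact: measurable_funP.
  have fin : P (X i @^-1` B) \is a fin_num by exact: fin_num_measure.
  split; last by move=> j; rewrite fineK// (location_preimage_eq model j i mB).
  by rewrite fine_ge0//= -lee_fin fineK//; exact: probability_le1.
have mgc a b : measurable (grid_cell K a b) by exact: measurable_rectangle.
have mw a b : measurable (window K a b) by exact: measurable_rectangle.
pose outside := \bigcup_(j in [set: 'I_n]) (X j @^-1` (~` @unit_square R)).
pose few (ab : 'I_K * 'I_K) :=
  [set t | (#|occupants (X := X) (grid_cell K ab.1 ab.2) t| <= 2 * m)%N].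
pose cuts (ab : 'I_K * 'I_K) :=
  \bigcup_AS cut_piece (Z := Z) (X := X) i m (window K ab.1 ab.2) AS.
have moutside : measurable outside.
  apply: fin_bigcup_measurable => // j _; rewrite -[X in measurable X]setTI.
  by apply: measurable_funP => //; apply: measurableC; exact: measurable_unit_square.
have mfew ab : measurable (few ab).
  exact: (measurable_occupants (mgc _ _) (fun A => #|A| <= 2 * m)%N).
have mcuts ab : measurable (cuts ab).
  by apply: fin_bigcup_measurable => // AS _; exact: measurable_cut_piece.
have mFew : measurable (\bigcup_ab few ab) by exact: fin_bigcup_measurable.
have mCuts : measurable (\bigcup_ab cuts ab) by exact: fin_bigcup_measurable.
have m0 : (0 < m)%N by rewrite -(ltr_nat R); lra.
have n0 : (0 < n)%N := leq_ltn_trans (leq0n i) (ltn_ord i).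
have cell_sub (a b c e : R) (a' b' c' e' : R) : a' <= a -> b <= b' -> c' <= c -> e <= e' ->
    rectangle a b c e `<=` rectangle a' b' c' e'.
  move=> *; move=> x [/=]; rewrite !in_itv/= => /andP[? ?] /andP[? ?].
  by split; rewrite /= in_itv/=; apply/andP; split; lra.
have leK (a b : nat) : (a <= b)%N -> a%:R / K%:R <= b%:R / K%:R :> R.
  by move=> ab; rewrite ler_wpM2r ?invr_ge0// ler_nat.
have few_large t a b : (a < K)%N -> (b < K)%N -> ~ (\bigcup_ab few ab) t ->
    (2 * m < #|occupants (X := X) (grid_cell K a b) t|)%N.
  move=> aK bK nfew; rewrite ltnNge; apply/negP => h; apply: nfew.
  by exists (Ordinal aK, Ordinal bK).
have occ_sub (B B' : set (R * R)) t v : B `<=` B' ->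
    v \in occupants (X := X) B t -> v \in occupants (X := X) B' t.
  by move=> BB'; rewrite !inE; exact: BB'.
have bad_sub : [set t | ~~ inner_connected (G t) [set~ i]%SET] `<=`
    outside `|` ((\bigcup_ab few ab) `|` (\bigcup_ab cuts ab)).
  move=> t /= /negP bad; apply: contrapT => /not_orP[nout /not_orP[nfew ncuts]].
  apply: bad; apply: (@grid_connected _ _ _ K
    (fun a b => occupants (X := X) (grid_cell K a b) t)
    (fun a b => occupants (X := X) (window K a b) t) K0).
  - move=> v; have : unit_square (X v t).
      by apply: contrapT => h; apply: nout; exists v.
    move=> /(unit_square_cell K0)[[a b] hab]; exists a, b.
    by rewrite !ltn_ord inE; split=> //; apply/asboolP.
  - move=> a b aK bK; have := few_large t a b aK bK nfew.
    set A := occupants _ _ => mA; have : (1 < #|A|)%N.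
      by apply: leq_ltn_trans mA; rewrite muln_gt0.
    move=> /card_gt1P[u [v [uA vA uv]]].
    by have [ui|] := eqVneq u i; [exists v; rewrite // -ui eq_sym|exists u].
  - by move=> a b v; apply: occ_sub; apply: cell_sub => //; exact: leK.
  - by move=> a b v; apply: occ_sub; apply: cell_sub => //; exact: leK.
  - by move=> a b v; apply: occ_sub; apply: cell_sub => //; exact: leK.
  move=> a b u v aK bK uU vU ui vi.
  apply: (@window_connected _ _ _ _ _ _ _ r i m (window K a b) t) => //.
  - by move=> x x'; exact: window_diameter.
  - apply: leq_trans (few_large t a b aK bK nfew) _; apply: subset_leq_card.
    apply/fintype.subsetP => w; apply: occ_sub.
    by apply: cell_sub => //; exact: leK.
  - by move=> h; apply: ncuts; exists (Ordinal aK, Ordinal bK).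
have Poutside : P outside = 0%E.
  apply/eqP; rewrite eq_le measure_ge0 andbT.
  have mj j : measurable (X j @^-1` @unit_square R).
    by rewrite -[X in measurable X]setTI; apply: measurable_funP => //; exact: measurable_unit_square.
  have mjC j : measurable (X j @^-1` (~` @unit_square R)).
    by rewrite -preimage_setC; exact: measurableC.
  apply: (le_trans (measure_le_sum P moutside mjC (fun t h => h))).
  rewrite big1// => j _; transitivity (P (~` (X j @^-1` @unit_square R))) => //.
  rewrite probability_setC//.
  by rewrite (location_in_square hf model) subee.
have Pfew ab : (P (few ab) <= y%:E)%E.
  have [q01 Pq] := prob_q _ (mgc ab.1 ab.2).
  apply: le_trans (few_occupants_probability model (mgc _ _) _ q01 Pq) _.
  rewrite lee_fin ler_expR; set q := fine _ in q01 Pq *.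
  have qq0 : q0 <= q.
    rewrite -lee_fin -(Pq i); apply: le_trans (location_rectangle_ge heps1 hf hfeps model _ _ _ _).
    - by rewrite !cell_width -expr2 exprVn.
    - exact: leK.
    - exact: leK.
    rewrite unit_squareE; apply: cell_sub; rewrite ?divr_ge0//.
      by rewrite ler_pdivrMr// mul1r ler_nat.
    by rewrite ler_pdivrMr// mul1r ler_nat.
  have nqq0 : n%:R * q0 <= n%:R * q by rewrite ler_wpM2l.
  have eD64 : eps1 * D / 16 <= n%:R * q0.
    by apply: le_trans nq0; rewrite ler_wpM2r.
  rewrite natrM; move: nqq0 m4 eD64 eD.
  set a := n%:R * q0; set a' := n%:R * q; set c := eps1 * D => *; lra.
have Pcuts ab : (P (cuts ab) <= (2 * n%:R * y)%:E)%E.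
  have [q01 Pq] := prob_q _ (mw ab.1 ab.2).
  apply: le_trans (cut_pieces_probability model p01' i m (mw _ _) q01 Pq) _.
  rewrite lee_fin lerBlDl; apply: le_trans (exprD1_le _ ny); last exact: expR_ge0.
  by rewrite lerXn2r ?nnegrE ?addr_ge0 ?expR_ge0// lerD2l.
have mbad : measurable [set t | ~~ inner_connected (G t) [set~ i]%SET].
  exact: (measurable_graph r (fun G0 => ~~ inner_connected G0 [set~ i]%SET)).
apply: (@le_trans _ _ (P (outside `|` ((\bigcup_ab few ab) `|` (\bigcup_ab cuts ab))))).
  by apply: le_measure; rewrite ?inE//; apply: measurableU => //; exact: measurableU.
apply: (le_trans (measureU2 _ _ _)) => //; first exact: measurableU.
rewrite [X in (X + _ <= _)%E]Poutside add0e; apply: (le_trans (measureU2 _ _ _)) => //.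
apply: (le_trans (leeD (measure_le_sum P mFew mfew (fun t h => h))
  (measure_le_sum P mCuts mcuts (fun t h => h)))).
apply: (le_trans (leeD (lee_sum _ (fun ab _ => Pfew ab)) (lee_sum _ (fun ab _ => Pcuts ab)))).
rewrite !sumEFin -EFinD lee_fin !sumr_const.
have -> : #|{: 'I_K * 'I_K}| = (K * K)%N by rewrite card_prod card_ord.
rewrite -mulrnDl -[leLHS]mulr_natl natrM -expr2.
have y0 : 0 <= y by exact: expR_ge0.
(* [D >= 1] forces [n * r ^+ 2 >= 1], while [K * r <= 4]. *)
have K16 : K%:R ^+ 2 <= 16 * n%:R :> R.
  have nr1 : 1 <= n%:R * r ^+ 2 by exact: le_trans nr.
  apply: (@le_trans _ _ (K%:R ^+ 2 * (n%:R * r ^+ 2))).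
    by rewrite -[leLHS]mulr1 ler_wpM2l ?sqr_ge0.
  by rewrite mulrCA mulrC ler_wpM2r.
apply: (@le_trans _ _ (16 * n%:R * (3 * n%:R * y))); last first.
  by rewrite le_eqVlt; apply/orP; left; apply/eqP; ring.
have ny0 : 0 <= n%:R * y by exact: mulr_ge0.
have ny1 : y <= n%:R * y by rewrite -[leLHS]mul1r ler_wpM2r// ler1n.
apply: ler_pM; [exact: sqr_ge0| |exact: K16|].
  by rewrite -mulrA addr_ge0// mulr_ge0.
by rewrite -!mulrA; move: ny1; set u := n%:R * y => *; lra.
Qed.

End disconnection.

(** * Variance of the maximum spanning tree weight *)

Section max_spanning_tree_dependence.
Context {R : realType} {n : nat}.

Lemma max_spanning_tree_weight_inner (G G' : {set edge n}) (C : {set 'I_n})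
    (w w' : edge n -> R) : inner G C = inner G' C ->
    (forall e : edge n, val e \subset C -> w e = w' e) ->
  max_spanning_tree_weight G C w = max_spanning_tree_weight G' C w'.
Proof.
move=> GG' ww'.
have sub (G1 G2 : {set edge n}) T : inner G1 C = inner G2 C ->
    spanning_tree G1 C T -> spanning_tree G2 C T.
  move=> E [TG TC Tcon aT]; split=> //.
  apply/fintype.subsetP => e eT; have : e \in inner G1 C.
    by rewrite inE (fintype.subsetP TG)// TC.
  by rewrite E inE => /andP[].
apply: eq_big => [T|T /asboolP[_ TC _ _]].
  by apply/asboolP/asboolP; apply: sub.
by apply: eq_bigr => e eT; apply: ww'; exact: TC.
Qed.

End max_spanning_tree_dependence.

Section measurable_bigmax.
Context {R : realType} {d} {T : measurableType d}.

Lemma measurable_bigmax {I : Type} (s : seq I) (Q : pred I) (h : I -> T -> R) :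
  (forall i, measurable_fun setT (h i)) ->
  measurable_fun setT (fun t => \big[Num.max/0]_(i <- s | Q i) h i t).
Proof.
move=> mh; elim: s => [|i s IH].
  by under eq_fun do rewrite big_nil; exact: measurable_cst.
under eq_fun do rewrite big_cons; case: (Q i) => //.
exact: measurable_maxr.
Qed.

Lemma measurable_max_spanning_tree_weight {n : nat} (G : {set edge n})
    (C : {set 'I_n}) (w : edge n -> T -> R) :
  (forall e, measurable_fun setT (w e)) ->
  measurable_fun setT (fun t => max_spanning_tree_weight G C (w^~ t)).
Proof.
move=> mw; apply: measurable_bigmax => S; rewrite /weight.
rewrite (_ : (fun t => _) = fun t => \sum_(e <- enum S) w e t).
  exact: measurable_sum.
by apply/funext => t; rewrite big_enum.
Qed.

Lemma measurable_select {S : finType} (F : T -> S) (h : S -> T -> R) :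
    (forall x, measurable [set t | F t = x]) ->
    (forall x, measurable_fun setT (h x)) ->
  measurable_fun setT (fun t => h (F t) t).
Proof.
move=> mF mh.
rewrite (_ : (fun t => _) = fun t => \sum_(x <- index_enum S) \1_([set t | F t = x]) t * h x t).
  by apply: measurable_sum => x; apply: measurable_funM => //; exact: measurable_indic.
apply/funext => t; rewrite (bigD1 (F t))//= indicE mem_set// mul1r big1 ?addr0// => x xF.
by rewrite indicE memNset ?mul0r//= => E; rewrite E eqxx in xF.
Qed.

End measurable_bigmax.

Section variance.
Context {R : realType} {eps1 eps2 : R} {f : R * R -> R} {Fc : R -> R} {d}
  {Omega : measurableType d} {P : probability Omega R} {n : nat} {p : R}
  {Z : edge n -> {RV P >-> bool}} {W : edge n -> {RV P >-> R}}
  {X : 'I_n -> {RV P >-> (R * R)%type}}.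
Hypothesis model : bernoulli_rgg_model f Fc p Z W X.
Variable r : R.

Let G := graph (Z := Z) (X := X) r.
Let w (t : Omega) (e : edge n) := W e t.

(* All the variables of the model are indexed by one finite type and take
   their values in [R * R]: locations as they are, then the states and the
   weights of the edges as first components. *)
Let index := ('I_n + (edge n + edge n))%type.

Let state_code (b : bool) : R * R := (b%:R, 0).
Let weight_code (x : R) : R * R := (x, 0).

Let measurable_state_code : measurable_fun setT state_code.
Proof. by apply: measurable_fun_pair => //; exact: measurable_fun_bool. Qed.

Let measurable_weight_code : measurable_fun setT weight_code.
Proof. exact: measurable_fun_pair. Qed.

Let coordinate_fun (k : index) : Omega -> R * R :=
  match k with
  | inl i => X i
  | inr (inl e) => state_code \o Z e
  | inr (inr e) => weight_code \o W e
  end.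

Let measurable_coordinate k : measurable_fun setT (coordinate_fun k).
Proof.
case: k => [i|[e|e]] /=; first exact: measurable_funP.
  by apply: measurableT_comp => //; exact: measurable_funP.
by apply: measurableT_comp => //; exact: measurable_funP.
Qed.

Let coordinate (k : index) : {RV P >-> (R * R)%type} :=
  HB.pack (coordinate_fun k) (isMeasurableFun.Build _ _ _ _ _ (measurable_coordinate k)).

Let coordinates_indep (A : index -> set (R * R)) : (forall k, measurable (A k)) ->
  (P (\bigcap_(k in setT) (coordinate k @^-1` A k)) = \prod_k P (coordinate k @^-1` A k))%E.
Proof.
move=> mA.
pose AZ e := state_code @^-1` A (inr (inl e)).
pose AW e := weight_code @^-1` A (inr (inr e)).
have mAZ e : measurable (AZ e) by rewrite -[AZ e]setTI; exact: measurable_state_code.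
have mAW e : measurable (AW e) by rewrite -[AW e]setTI; exact: measurable_weight_code.
rewrite (_ : \bigcap_(k in setT) _ = (\bigcap_(e in setT) (Z e @^-1` AZ e)) `&`
    (\bigcap_(e in setT) (W e @^-1` AW e)) `&`
    (\bigcap_(i in setT) (X i @^-1` A (inl i)))); last first.
  apply/seteqP; split=> t /=.
    move=> h; split; [split|] => k _.
    - exact: (h (inr (inl k))).
    - exact: (h (inr (inr k))).
    - exact: (h (inl k)).
  by move=> [[hZ hW] hX] [i|[e|e]] _; [exact: hX|exact: hZ|exact: hW].
rewrite (families_indep model); [|exact: family_sigma_bigcap..].
rewrite (mutually_independent_setT (state_indep model))//.
rewrite (mutually_independent_setT (weight_indep model))//.
rewrite (mutually_independent_setT (location_indep model))//.
by rewrite !big_sumType/= muleC.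
Qed.

(** Decoding on the coordinate space, where Efron-Stein applies: an edge has state 1 when its coded
    first component is 1. *)
Let vgraph (v : family index (R * R)%type) : {set edge n} :=
  rgg r (fun e => (v (inr (inl e))).1 == 1) (fun i => v (inl i)).
Let vweight (v : family index (R * R)%type) (e : edge n) : R := (v (inr (inr e))).1.

Let vgraph_joint t : vgraph (joint coordinate t) = G t.
Proof.
rewrite /vgraph /G /graph; congr rgg; apply/funext => e.
rewrite /joint /=; case: (Z e t); first by rewrite eqxx.
by apply/negbTE; rewrite eq_sym oner_neq0.
Qed.

Let measurable_vgraph_eq G0 : measurable [set v | vgraph v = G0].
Proof.
have := @measurable_rgg _ _ (family index (R * R)%type) n r
  (fun e v => (v (inr (inl e))).1 == 1) (fun i v => v (inl i)) (pred1 G0).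
have m1 (k : index) : measurable_fun setT (fun v : family index (R * R)%type => (v k).1).
  by apply: measurableT_comp => //; exact: measurable_coord.
move=> h; rewrite (_ : [set v | _] = [set v | pred1 G0 (vgraph v)]).
  apply: h => [e|i]; last exact: measurable_coord.
  exact: measurable_fun_eqr.
by apply/seteqP; split=> v /= /eqP.
Qed.

Let measurable_vmax (C : {set edge n} -> {set 'I_n}) : measurable_fun setT
  (fun v => max_spanning_tree_weight (vgraph v) (C (vgraph v)) (vweight v)).
Proof.
apply: (measurable_select (h := fun G0 v => max_spanning_tree_weight G0 (C G0) (vweight v))) => // G0.
apply: (@measurable_max_spanning_tree_weight _ _ _ n G0 (C G0) (fun e v => vweight v e)) => e.
by apply: measurableT_comp => //; exact: measurable_coord.
Qed.

Let vertex_exists (e : edge n) : exists u, u \in val e.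
Proof. by apply/card_gt0P; rewrite (eqP (valP e)). Qed.

(** An edge goes to one chosen endpoint, which makes the blocks a partition in which block [i]
    contains only edges at [i]. *)
Let block (k : index) : 'I_n :=
  match k with
  | inl i => i
  | inr (inl e) | inr (inr e) => xchoose (vertex_exists e)
  end.

Let vmax_block i (v v' : family index (R * R)%type) :
    (forall k, block k != i -> v k = v' k) ->
  max_spanning_tree_weight (vgraph v) [set~ i]%SET (vweight v) =
  max_spanning_tree_weight (vgraph v') [set~ i]%SET (vweight v').
Proof.
move=> vv'.
have bi (e : edge n) : val e \subset [set~ i]%SET -> xchoose (vertex_exists e) != i.
  by move=> /fintype.subsetP/(_ _ (xchooseP (vertex_exists e))); rewrite !inE.
apply: max_spanning_tree_weight_inner; last first.
  by move=> e /bi ei; rewrite /vweight vv'.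
apply/setP => e; rewrite !inE; have [eC|] := boolP (val e \subset _); last by rewrite !andbF.
rewrite !andbT (vv' (inr (inl e)) (bi e eC)); congr (_ && _).
have vi u : u \in val e -> v (inl u) = v' (inl u).
  by move=> /(fintype.subsetP eC); rewrite !inE => ui; exact: vv'.
apply: eq_forallb_in => u ue; apply: eq_forallb_in => x xe.
by rewrite (vi u)// (vi x).
Qed.

Hypothesis heps1 : 0 < eps1.
Hypothesis heps12 : eps1 <= eps2.
Hypothesis hf : density_on_square f.
Hypothesis hfeps : forall x, unit_square x -> eps1 <= f x <= eps2.
Hypothesis p01 : 0 < p < 1.
Hypothesis r01 : 0 < r < 1.
Hypothesis n2 : (2 < n)%N.
(** [B] is meant to depend on [L] and [s1] and serves the incident weight; [B1] is meant to be a
    constant and serves the total weight on the event of disconnection. *)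
Variables (B B1 : R).
Hypotheses (B0 : 0 <= B) (B10 : 0 <= B1).
Hypothesis moment_le : forall (phi : pred {set edge n}) e,
  (\int[P]_(t in [set t | phi (G t)]) ((W e t) ^+ 2)%:E
    <= P [set t | phi (G t)] * B%:E)%E.
Hypothesis moment_le1 : forall (phi : pred {set edge n}) e,
  (\int[P]_(t in [set t | phi (G t)]) ((W e t) ^+ 2)%:E
    <= P [set t | phi (G t)] * B1%:E)%E.
Variable tie : forall n, {set edge n} -> {set 'I_n}.
Hypothesis htie : tie_breaking_rule tie.

Let w0 t e : 0 < w t e. Proof. exact: weight_gt0 model e t. Qed.

Let total t := \sum_e w t e.

Let total0 t : 0 <= total t. Proof. by apply: sumr_ge0 => e _; exact: ltW. Qed.

Let mW e : measurable_fun setT (fun t => w t e).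
Proof. exact: measurable_funP. Qed.

Let mtotal2 : measurable_fun setT (fun t => (total t ^+ 2)%:E).
Proof.
by apply/measurable_EFinP; apply: measurable_funX; apply: measurable_sum => e; exact: mW.
Qed.

Let taux t := max_spanning_tree_weight (G t) (tie (G t)) (w t).

Let measurable_taux : measurable_fun setT taux.
Proof.
rewrite (_ : taux = fun t => max_spanning_tree_weight (vgraph (joint coordinate t))
    (tie (vgraph (joint coordinate t))) (vweight (joint coordinate t))).
  exact: measurableT_comp (measurable_vmax (tie (n := n))) (measurable_joint coordinate).
by apply/funext => t; rewrite vgraph_joint.
Qed.

Let total_moment_lty : (\int[P]_t (total t ^+ 2)%:E < +oo)%E.
Proof.
have := total_weight_moment (r := r) B10 moment_le1 xpredT.
rewrite (_ : [set t | _] = setT); last by apply/seteqP; split.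
by rewrite probability_setT mul1e => h; apply: le_lt_trans h _; rewrite ltry.
Qed.

Let taux_total t : 0 <= taux t <= total t.
Proof.
apply/andP; split; first exact: max_spanning_tree_weight_ge0.
exact: max_spanning_tree_weight_bound.
Qed.

Let tau_Lfun : taux \in Lfun P 2%:E.
Proof.
rewrite inE; apply/andP; split; rewrite inE//=.
rewrite /finite_norm unlock; apply: poweR_lty.
apply: le_lt_trans total_moment_lty; apply: ge0_le_integral => //.
- by move=> t _; exact: poweR_ge0.
- under eq_fun do rewrite /= -[2]/(2%:R) powR_mulrn//.
  apply/measurable_EFinP; apply: measurable_funX; exact: measurableT_comp.
move=> t _ /=; rewrite -[2]/(2%:R) powR_mulrn// lee_fin.
have /andP[t0 tt] := taux_total t.
by rewrite ger0_norm// lerXn2r ?nnegrE// (le_trans t0).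
Qed.

Let mincident i : measurable_fun setT (fun t => (incident_weight (G t) (w t) i ^+ 2)%:E).
Proof.
apply/measurable_EFinP; apply: measurable_funX; exact: measurable_incident_weight.
Qed.

(** Without connectivity there is no comparison of trees, but both tree weights still lie between 0
    and the total weight. *)
Let sqr_delete i t :
  (taux t - max_spanning_tree_weight (G t) [set~ i]%SET (w t)) ^+ 2 <=
  incident_weight (G t) (w t) i ^+ 2 +
    (~~ inner_connected (G t) [set~ i]%SET)%:R * total t ^+ 2.
Proof.
have inc0 : 0 <= incident_weight (G t) (w t) i by apply: sumr_ge0 => e _; exact: ltW.
rewrite -real_normK ?num_real//; have [conn|_] := boolP (inner_connected (G t) [set~ i]%SET).
  rewrite mul0r addr0 lerXn2r ?nnegrE//.
  by apply: max_spanning_tree_weight_delete => //; apply: htie; exact: ltn_trans n2.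
rewrite mul1r -[leLHS]add0r lerD ?sqr_ge0// lerXn2r ?nnegrE//.
have h1 C : 0 <= max_spanning_tree_weight (G t) C (w t) by exact: max_spanning_tree_weight_ge0.
have h2 C : max_spanning_tree_weight (G t) C (w t) <= total t.
  exact: max_spanning_tree_weight_bound.
rewrite ler_norml; have := h1 (tie (G t)); have := h2 (tie (G t)).
have := h1 [set~ i]%SET; have := h2 [set~ i]%SET; rewrite -/(taux t).
by move=> *; apply/andP; split; lra.
Qed.

(** The factor [4 * n] is from Efron-Stein over [n] blocks, [9 * eps2 * D] is the bound on the
    expected degree, and [n ^ 6] is [n ^ 2] from the disconnection bound times [n ^ 4] from the
    total weight. *)
Lemma variance_tau_le :
    let D := n%:R * r ^+ 2 * p in let y := expR (- (eps1 * D / 256)) in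
    1 <= D -> 256 <= eps1 * D -> n%:R * y <= 2^-1 ->
  ('V_P[tau tie r Z W X] <=
    (4 * n%:R * (B * (eps2 * (9 * eps2 * D + (9 * eps2 * D) ^+ 2)) +
                 48 * B1 * n%:R ^+ 6 * y))%:E)%E.
Proof.
move=> D y D1 eD ny.
have tauE : tau tie r Z W X = fun t => max_spanning_tree_weight
    (vgraph (joint coordinate t)) (tie (vgraph (joint coordinate t))) (vweight (joint coordinate t)).
  by apply/funext => t; rewrite vgraph_joint.
rewrite tauE; apply: le_trans (efron_stein coordinates_indep
  (f := fun v => max_spanning_tree_weight (vgraph v) (tie (vgraph v)) (vweight v))
  (measurable_vmax (tie (n := n))) (b := block)
  (fi := fun i v => max_spanning_tree_weight (vgraph v) [set~ i]%SET (vweight v))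
  (fun i => measurable_vmax (fun=> [set~ i]%SET)) vmax_block _) _.
  by rewrite -tauE; exact: tau_Lfun.
rewrite -mulrA EFinM lee_pmul2l ?lte_fin//.
apply: (@le_trans _ _ (\sum_(i < n) (B * (eps2 * (9 * eps2 * D + (9 * eps2 * D) ^+ 2)) +
                 48 * B1 * n%:R ^+ 6 * y)%:E)%E); last first.
  by rewrite sumEFin lee_fin sumr_const card_ord -[leLHS]mulr_natl.
apply: lee_sum => i _.
pose bad t := ~~ inner_connected (G t) [set~ i]%SET.
have mbad : measurable_fun setT (fun t => ((bad t)%:R * total t ^+ 2)%:E).
  apply/measurable_EFinP; apply: measurable_funM; last exact/measurable_EFinP.
  exact: (measurable_graph_event r (fun G0 => ~~ inner_connected G0 [set~ i]%SET)).
have bad0 t : (0 <= ((bad t)%:R * total t ^+ 2)%:E)%E.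
  by rewrite lee_fin mulr_ge0// sqr_ge0.
have inc0 t : (0 <= (incident_weight (G t) (w t) i ^+ 2)%:E)%E.
  by rewrite lee_fin sqr_ge0.
apply: (@le_trans _ _ (\int[P]_t ((incident_weight (G t) (w t) i ^+ 2)%:E +
    ((bad t)%:R * total t ^+ 2)%:E))%E).
  apply: ge0_le_integral => //.
  - by move=> t _; rewrite lee_fin sqr_ge0.
  - apply/measurable_EFinP; apply: measurable_funX; apply: measurable_funB.
      exact: measurableT_comp (measurable_vmax (tie (n := n))) (measurable_joint coordinate).
    exact: measurableT_comp (measurable_vmax (fun=> [set~ i]%SET)) (measurable_joint coordinate).
  - exact: emeasurable_funD.
  by move=> t _; rewrite vgraph_joint -EFinD lee_fin; exact: sqr_delete.
rewrite ge0_integralD// EFinD; apply: leeD.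
  have p0 : 0 <= p by case/andP: p01 => /ltW.
  have := incident_weight_moment heps1 heps12 hf hfeps model p0 r01 B0 moment_le i.
  by rewrite (_ : n%:R * (9 * eps2 * p * r ^+ 2) = 9 * eps2 * D)//; rewrite /D; ring.
rewrite (integral_graph_event r (fun G0 => ~~ inner_connected G0 [set~ i]%SET)).
apply: (le_trans (total_weight_moment (r := r) B10 moment_le1
  (fun G0 => ~~ inner_connected G0 [set~ i]%SET))).
apply: (@le_trans _ _ ((48 * n%:R ^+ 2 * y)%:E * (n%:R ^+ 4 * B1)%:E)%E).
  rewrite lee_wpmul2r ?lee_fin ?mulr_ge0 ?exprn_ge0//.
  exact: (disconnected_probability heps1 hf hfeps model p01 r01).
by rewrite -EFinM lee_fin le_eqVlt; apply/orP; left; apply/eqP; ring.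
Qed.

End variance.

(** * Choice of the constants *)

Lemma ccdf_of_positive_bounds {R : realType} (Fc : R -> R) : ccdf_of_positive Fc ->
  (forall x, 0 < x -> 0 <= Fc x <= 1) /\
  (forall x y, 0 < x -> x <= y -> Fc y <= Fc x).
Proof.
case=> ? [T0 [P [V [_ WFc]]]]; split=> [x x0|x y x0 xy].
  by rewrite -!lee_fin -WFc// measure_ge0 probability_le1.
rewrite -lee_fin -!WFc//; last exact: lt_le_trans xy.
exact: ccdf_nonincreasing.
Qed.

Lemma near_infty_ln_large {R : realType} (K : R) : \forall n \near \oo,
  [/\ (2 < n)%N, 1 <= ln (n%:R : R) & K <= n%:R ^+ 2].
Proof.
near=> n; have n2 : (2 < n)%N by near: n; exact: nbhs_infty_gt.
split=> //.
  rewrite -[leLHS]expRK ler_ln ?posrE ?expR_gt0 ?ltr0n//; last exact: ltn_trans n2.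
  by near: n; exact: nbhs_infty_ger.
have Kn : K <= n%:R by near: n; exact: nbhs_infty_ger.
apply: (le_trans Kn); rewrite -natrX ler_nat -{1}(expn1 n) leq_exp2l//.
exact: ltn_trans n2.
Unshelve. all: by end_near. Qed.

Theorem theorem2 (R : realType) (eps1 eps2 : R) (f : R * R -> R)
    (Fc : R -> R) (C x0 s : R)
    (heps1 : 0 < eps1) (heps12 : eps1 <= eps2)
    (hf : density_on_square f)
    (hfeps : forall x, unit_square x -> eps1 <= f x <= eps2)
    (hFc : ccdf_of_positive Fc)
    (hC : 0 < C) (hx0 : 0 < x0) (hs : 3 < s)
    (htail : forall a x, 1 < a -> x0 < x -> Fc (a * x) <= C / a `^ s * Fc x) :
  exists gamma : R, 0 < gamma /\
    forall (M : R), gamma < M ->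
    forall (r p : nat -> R),
      (forall n, 0 < r n < 1) -> (forall n, 0 < p n < 1) ->
      (\forall n \near \oo, M * ln n%:R <= n%:R * r n ^+ 2 * p n) ->
    forall (L : nat -> R), (forall n, 0 < L n) ->
    forall (s1 : R), 2 < s1 < s ->
    forall (tie : forall n, {set edge n} -> {set 'I_n}),
      tie_breaking_rule tie ->
    forall (d : nat -> measure_display)
      (Omega : forall n, measurableType (d n))
      (P : forall n, probability (Omega n) R)
      (Z : forall n, edge n -> {RV (P n) >-> bool})
      (W : forall n, edge n -> {RV (P n) >-> R})
      (X : forall n, 'I_n -> {RV (P n) >-> (R * R)%type}),
      (forall n, bernoulli_rgg_model f Fc (p n) (Z n) (W n) (X n)) ->
    \forall n \near \oo,
      ('V_(P n)[tau tie (r n) (Z n) (W n) (X n)] <=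
       (gamma * n%:R * (sigma_loc2 Fc gamma s1 n (r n) (p n) (L n)
                        + sigma_wt2 Fc n (r n) (p n)))%:E)%E.
Proof.
have [Fc01 Fc_mono] := ccdf_of_positive_bounds hFc.
have e20 : 0 < eps2 by exact: lt_le_trans heps12.
have s3 : 2 < (3 : R) < s by rewrite hs ltr_nat.
(* The bound of [second_moment_le] at [L = 1] and [s1 = 3], admissible since [3 < s]; it must be
   fixed before [L] and [s1] to enter [gamma]. *)
pose B1 := 1 ^+ 2 + moment_cst C x0 s 3 * Fc 1 `^ (1 - 2 / 3).
have B10 : 0 <= B1.
  by rewrite addr_ge0 ?sqr_ge0// mulr_ge0 ?powR_ge0// moment_cst_ge0.
pose c := 9 * eps2 ^+ 2 + 81 * eps2 ^+ 3.
have c0 : 0 <= c by rewrite addr_ge0// mulr_ge0// exprn_ge0// ltW.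
(* [1] makes [D >= log n >= 1], [4 * c] covers the incident weights, [192 = 4 * 48] the
   disconnection, and [512 / eps1] the decay of [y]. *)
pose gamma := 1 + 4 * c + 192 * B1 + 512 / eps1.
have e1V : 0 < 512 / eps1 by rewrite divr_gt0.
have gamma1 : 1 <= gamma by rewrite /gamma; lra.
have gammac : 4 * c <= gamma by rewrite /gamma; lra.
have gammaB : 192 * B1 <= gamma by rewrite /gamma; lra.
have gammae : 512 / eps1 <= gamma by rewrite /gamma; lra.
have gamma0 : 0 < gamma by exact: lt_le_trans gamma1.
exists gamma; split=> // M gM r p r01 p01 hM L L0 s1 hs1 tie htie d Omega P Z W X model.
near=> n.
have [n2 ln1 Kn] : [/\ (2 < n)%N, 1 <= ln (n%:R : R) & moment_cst C x0 s s1 <= n%:R ^+ 2].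
  by near: n; exact: near_infty_ln_large.
have MD : M * ln n%:R <= n%:R * r n ^+ 2 * p n by near: n; exact: hM.
set D := n%:R * r n ^+ 2 * p n in MD *.
pose y := expR (- (eps1 * D / 256)).
have gD : gamma * ln n%:R <= D.
  by apply: le_trans MD; apply: ler_wpM2r; [exact: le_trans ln1|exact: ltW].
have D1 : 1 <= D by apply: le_trans gD; rewrite -[leLHS]mulr1 ler_pM.
have eD2 : 512 * ln n%:R <= eps1 * D.
  rewrite -ler_pdivrMl// mulrA [_^-1 * _]mulrC; apply: le_trans gD.
  by rewrite ler_wpM2r// (le_trans _ ln1).
have eD : 256 <= eps1 * D by apply: le_trans eD2; lra.
have nR : 0 < n%:R :> R by rewrite ltr0n (ltn_trans _ n2).
(* [eps1 * D >= 512 * log n] gives [y <= n ^ (-2)], with exponent [512 / 256 = 2]. *)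
have ny : n%:R * y <= 2^-1.
  apply: (@le_trans _ _ (n%:R * (n%:R^-1 * n%:R^-1))).
    have nV : n%:R^-1 = expR (- ln n%:R) :> R by rewrite expRN lnK ?posrE.
    rewrite (ler_wpM2l (ltW nR))// nV -expRD /y ler_expR.
    by move: eD2; set a := ln _; set b := eps1 * D => *; lra.
  rewrite mulrA mulfV ?gt_eqF// mul1r lef_pV2 ?posrE// ler_nat; exact: ltnW.
have D0 : 0 <= D by exact: le_trans D1.
have Fth0 : 0 <= Fc (L n) `^ (1 - 2 / s1) by exact: powR_ge0.
pose B := L n ^+ 2 + moment_cst C x0 s s1 * Fc (L n) `^ (1 - 2 / s1).
have B0 : 0 <= B.
  by rewrite addr_ge0 ?sqr_ge0// mulr_ge0// moment_cst_ge0.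
have moment (l t : R) : 0 < l -> 2 < t < s -> forall (phi : pred {set edge n}) e,
    (\int[P n]_(u in [set u | phi (graph (Z := Z n) (X := X n) (r n) u)]) ((W n e u) ^+ 2)%:E
     <= P n [set u | phi (graph (Z := Z n) (X := X n) (r n) u)] *
        (l ^+ 2 + moment_cst C x0 s t * Fc l `^ (1 - 2 / t))%:E)%E.
  move=> l0 ht phi e; apply: second_moment_le => //.
  - exact: (weight_gt0 (model n)).
  - exact: measurable_graph.
  - by move=> u u0; exact: (indep_graph_weight (model n) (r n) phi e u0).
have := variance_tau_le (model n) heps1 heps12 hf hfeps (p01 n) (r01 n) n2 B0 B10
  (moment _ _ (L0 n) hs1) (moment _ _ ltr01 s3) htie D1 eD ny.
move=> /le_trans; apply; rewrite lee_fin -/D -/y.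
have Q0 : 0 <= n%:R ^+ 4 * r n ^+ 2 * p n * Fc (L n).
  have /andP[F0 _] := Fc01 _ (L0 n); have /andP[p0 _] := p01 n.
  by rewrite mulr_ge0// mulr_ge0 ?(ltW p0)// mulr_ge0 ?sqr_ge0// exprn_ge0.
rewrite /sigma_loc2 /sigma_wt2 -/D.
set H2 := tail_quantile _ _ ^+ 2; have H20 : 0 <= H2 by exact: sqr_ge0.
set Fth := Fc (L n) `^ _ in Fth0 B B0 *.
set Q := n%:R ^+ 4 * r n ^+ 2 * p n * Fc (L n) in Q0 *.
rewrite [4 * n%:R]mulrC [gamma * n%:R]mulrC -[leLHS]mulrA -[leRHS]mulrA.
apply: (ler_wpM2l (ltW nR)).
(* The moment constant depends on [s1], so it is absorbed by [n ^ 2] rather than by [gamma]. *)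
have BQ : B <= L n ^+ 2 + Q + n%:R ^+ 2 * Fth.
  by rewrite /B -addrA lerD2l (le_trans (ler_wpM2r Fth0 Kn))// lerDr.
have y_le : y <= expR (- (gamma^-1 * D)).
  rewrite ler_expR lerN2 mulrAC ler_wpM2r//.
  rewrite -[leRHS]invrK lef_pV2 ?posrE ?invr_gt0 ?divr_gt0// invf_div.
  by apply: le_trans gammae; rewrite ler_wpM2r ?invr_ge0 ?ltW//; lra.
(* The linear term is merged into the quadratic one because [D >= 1]. *)
have cD : eps2 * (9 * eps2 * D + (9 * eps2 * D) ^+ 2) <= c * D ^+ 2.
  have D2 : D <= D ^+ 2 by rewrite expr2 -[leLHS]mulr1 ler_wpM2l.
  have := ler_wpM2l (_ : 0 <= 9 * eps2 ^+ 2) D2; rewrite mulr_ge0 ?sqr_ge0// => /(_ isT).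
  rewrite /c; set u := D ^+ 2 => h.
  rewrite [leLHS](_ : _ = 9 * eps2 ^+ 2 * D + 81 * eps2 ^+ 3 * u); last by rewrite /u; ring.
  by rewrite [leRHS]mulrDl lerD2r.
have main : 4 * (B * (eps2 * (9 * eps2 * D + (9 * eps2 * D) ^+ 2))) <=
    gamma * (D ^+ 2 * (L n ^+ 2 + Q + n%:R ^+ 2 * Fth)).
  apply: (@le_trans _ _ (4 * c * (D ^+ 2 * B))).
    rewrite [leRHS](_ : _ = 4 * (B * (c * D ^+ 2))); last by ring.
    by apply: ler_wpM2l => //; exact: ler_wpM2l.
  apply: ler_pM => //; [by rewrite mulr_ge0|by rewrite mulr_ge0 ?sqr_ge0|].
  by rewrite ler_wpM2l ?sqr_ge0.
have rest : 192 * B1 * (n%:R ^+ 6 * y) <= gamma * (n%:R ^+ 6 * expR (- (gamma^-1 * D))).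
  have n60 : 0 <= n%:R ^+ 6 :> R by exact: exprn_ge0.
  apply: ler_pM => //; [by rewrite mulr_ge0|by rewrite mulr_ge0 ?expR_ge0|].
  by rewrite ler_wpM2l.
have gH : 0 <= gamma * H2 by rewrite mulr_ge0// ltW.
rewrite [leLHS](_ : _ = 4 * (B * (eps2 * (9 * eps2 * D + (9 * eps2 * D) ^+ 2)))
  + 192 * B1 * (n%:R ^+ 6 * y)); last by ring.
rewrite [leRHS]mulrDr [X in _ <= X + _]mulrDr -[leLHS]addr0; apply: lerD => //.
exact: lerD.
Unshelve. all: by end_near. Qed.
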